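(* Let $\mathbf{S}^{\mathrm{emb}}(1)$ be the category of all simplicial monoids with order-unit, with normalized monoid order-embeddings. There is no functor $\Gamma$ from $\mathbf{S}^{\mathrm{emb}}(1)$ to the category $\mathbf{RR_0}$ of all C*-algebras of real rank $0$ with C*-homomorphisms such that $\mathrm{V}\circ\Gamma\cong\mathrm{id}$. Likewise, there is no functor $\Gamma$ from $\mathbf{S}^{\mathrm{emb}}(1)$ to the category $\mathbf{Reg}$ of all (von Neumann) regular rings with ring homomorphisms such that $\mathrm{V}\circ\Gamma\cong\mathrm{id}$. (Here $\mathrm{V}\circ\Gamma\cong\mathrm{id}$ means that $\mathrm{V}\circ\Gamma$ is naturally isomorphic to the functor $(M,u)\mapsto M$, $f\mapsto f$, from $\mathbf{S}^{\mathrm{emb}}(1)$ to conical commutative monoids.)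
   Context: Rings and C*-algebras are not necessarily unital, and homomorphisms need not preserve units. A ring $R$ is regular if for each $x\in R$ there is $y\in R$ with $xyx=x$. A commutative monoid (written additively) is conical if $x+y=0$ implies $x=y=0$. A simplicial monoid is one isomorphic to $(\mathbb{Z}^+)^n$, $n\in\mathbb{Z}^+=\{0,1,2,\dots\}$. The algebraic preordering of a commutative monoid is $x\leq y$ iff $y=x+z$ for some $z$. An order-unit of $M$ is $u\in M$ such that each $x\in M$ satisfies $x\leq nu$ for some positive integer $n$. A normalized monoid order-embedding $(M,u)\to(N,w)$ is a monoid homomorphism $f\colon M\to N$ such that $f(u)=w$ and $f(x)\leq f(y)$ implies $x\leq y$, for all $x,y\in M$. For a ring $R$, $\mathrm{V}(R)$ is the commutative monoid of equivalence classes $[a]_R$ of idempotents $a$ of $\mathrm{M}_\infty(R)=\bigcup_n\mathrm{M}_n(R)$ (embedding $\mathrm{M}_n(R)$ into $\mathrm{M}_{n+1}(R)$ by adding a zero row and column), where $a\sim b$ if $a=xy$, $b=yx$ for some $x,y\in\mathrm{M}_\infty(R)$, with addition determined by $[a]_R+[b]_R=[a+b]_R$ whenever $ab=ba=0$. A ring homomorphism $f\colon R\to S$ induces $\mathrm{V}(f)\colon[a]_R\mapsto[f(a)]_S$, making $\mathrm{V}$ a functor to conical commutative monoids. *)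

(* Defs.v *)
From HB Require Import structures.
From mathcomp Require Import all_boot all_order all_algebra.
From mathcomp Require Import all_classical all_reals all_analysis.
From mathcomp Require Import complex.

Set Implicit Arguments.
Unset Strict Implicit.
Unset Printing Implicit Defensive.

Import Order.TTheory GRing.Theory Num.Theory.
Import numFieldNormedType.Exports.

Local Open Scope classical_set_scope.
Local Open Scope ring_scope.
Local Open Scope quotient_scope.

Record category := Category {
  obj :> Type;
  hom : obj -> obj -> Type;
  idm : forall X, hom X X;
  cmp : forall X Y Z, hom Y Z -> hom X Y -> hom X Z;
  cmp1m : forall X Y (f : hom X Y), cmp (idm Y) f = f;
  cmpm1 : forall X Y (f : hom X Y), cmp f (idm X) = f;
  cmpA : forall X Y Z T (h : hom Z T) (g : hom Y Z) (f : hom X Y),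
    cmp h (cmp g f) = cmp (cmp h g) f }.

Arguments idm {c} X.
Arguments cmp {c X Y Z}.

Record functor (C D : category) := Functor {
  fobj :> C -> D;
  fmap : forall X Y : C, hom X Y -> hom (fobj X) (fobj Y);
  fmap1 : forall X, fmap (idm X) = idm (fobj X);
  fmapM : forall X Y Z (g : hom Y Z) (f : hom X Y),
    fmap (cmp g f) = cmp (fmap g) (fmap f) }.

Arguments fmap {C D} _ {X Y}.

Section functor_comp.
Variables (C D E : category) (G : functor D E) (F : functor C D).

Lemma functor_comp1 X : fmap G (fmap F (idm X)) = idm (G (F X)).
Proof. by rewrite !fmap1. Qed.

Lemma functor_compM X Y Z (g : hom Y Z) (f : hom X Y) :
  fmap G (fmap F (cmp g f)) = cmp (fmap G (fmap F g)) (fmap G (fmap F f)).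
Proof. by rewrite !fmapM. Qed.

Definition functor_comp : functor C E := Functor functor_comp1 functor_compM.

End functor_comp.

Definition is_iso (C : category) (X Y : C) (f : hom X Y) : Prop :=
  exists g : hom Y X, cmp g f = idm X /\ cmp f g = idm Y.

Definition nat_isomorphic (C D : category) (F G : functor C D) : Prop :=
  exists eta : forall X : C, hom (F X) (G X),
    (forall X, is_iso (eta X)) /\
    (forall (X Y : C) (f : hom X Y),
      cmp (fmap G f) (eta X) = cmp (eta Y) (fmap F f)).

Lemma sval_inj (T : Type) (P : T -> Prop) (x y : {x | P x}) :
  sval x = sval y -> x = y.
Proof. by case: x y => [x Px] [y Py] /= xy; exact: eq_exist. Qed.

(* The category whose objects [X : O] have underlying types [T X] and whose
   morphisms are the functions satisfying [P]. *)
Section concrete_category.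
Variables (O : Type) (T : O -> Type) (P : forall X Y, set (T X -> T Y)).
Hypothesis P1 : forall X, @P X X idfun.
Hypothesis PM : forall X Y Z (g : T Y -> T Z) (f : T X -> T Y),
  @P Y Z g -> @P X Y f -> @P X Z (g \o f).

Definition chom X Y := {f : T X -> T Y | @P X Y f}.
Definition cidm X : chom X X := exist _ idfun (P1 X).
Definition ccmp X Y Z (g : chom Y Z) (f : chom X Y) : chom X Z :=
  exist _ (sval g \o sval f) (PM (svalP g) (svalP f)).

Fact ccmp1m X Y (f : chom X Y) : ccmp (cidm Y) f = f.
Proof. exact: sval_inj. Qed.

Fact ccmpm1 X Y (f : chom X Y) : ccmp f (cidm X) = f.
Proof. exact: sval_inj. Qed.

Fact ccmpA X Y Z U (h : chom Z U) (g : chom Y Z) (f : chom X Y) :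
  ccmp h (ccmp g f) = ccmp (ccmp h g) f.
Proof. exact: sval_inj. Qed.

Definition concrete_category : category := Category ccmp1m ccmpm1 ccmpA.

End concrete_category.

Definition conical (M : nmodType) : Prop :=
  forall x y : M, x + y = 0 -> x = 0 /\ y = 0.

Definition simplicial (M : nmodType) : Prop :=
  exists (n : nat) (f : M -> {ffun 'I_n -> nat}), nmod_morphism f /\ bijective f.

Definition alg_le (M : nmodType) (x y : M) : Prop := exists z, y = x + z.

Definition order_unit (M : nmodType) (u : M) : Prop :=
  forall x : M, exists2 n, (0 < n)%N & alg_le x (u *+ n).

Definition order_embedding (M N : nmodType) (f : M -> N) : Prop :=
  nmod_morphism f /\ forall x y, alg_le (f x) (f y) -> alg_le x y.

Lemma nmod_morphism_id (M : nmodType) : nmod_morphism (@idfun M).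
Proof. by []. Qed.

Lemma nmod_morphism_comp (M N P : nmodType) (g : N -> P) (f : M -> N) :
  nmod_morphism g -> nmod_morphism f -> nmod_morphism (g \o f).
Proof. by move=> [g0 gD] [f0 fD]; split=> [|x y] /=; rewrite ?f0 // fD gD. Qed.

Definition CMon_obj := {M : nmodType | conical M}.

Definition CMon : category :=
  @concrete_category CMon_obj (fun M => sval M)
    (fun M N => [set f : sval M -> sval N | nmod_morphism f])
    (fun M => nmod_morphism_id (sval M))
    (fun M N P g f => @nmod_morphism_comp _ _ _ g f).

Record simplicial_with_unit := SimplicialWithUnit {
  swu_monoid :> nmodType;
  swu_unit : swu_monoid;
  swu_simplicial : simplicial swu_monoid;
  swu_order_unit : order_unit swu_unit }.

Definition normalized_embedding (M N : simplicial_with_unit) : set (M -> N) :=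
  [set f | order_embedding f /\ f (swu_unit M) = swu_unit N].

Lemma normalized_embedding_id (M : simplicial_with_unit) :
  normalized_embedding (@idfun M).
Proof. by []. Qed.

Lemma normalized_embedding_comp (M N P : simplicial_with_unit)
    (g : N -> P) (f : M -> N) :
  normalized_embedding g -> normalized_embedding f ->
  normalized_embedding (g \o f).
Proof.
move=> [[gA gE] gu] [[fA fE] fu]; split; last by rewrite /= fu gu.
by split; [exact: nmod_morphism_comp|move=> x y /gE/fE].
Qed.

Definition Semb1 : category :=
  concrete_category normalized_embedding_id normalized_embedding_comp.

Lemma simplicial_conical (M : nmodType) : simplicial M -> conical M.
Proof.
case=> n [f [[f0 fD] /bij_inj f_inj]] x y xy0.
have fxy i : (f x i + f y i)%N = 0%N.
  by have := fD x y; rewrite xy0 f0 => /ffunP/(_ i); rewrite !ffunE.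
split; apply: f_inj; rewrite f0; apply/ffunP => i; rewrite ffunE; apply/eqP;
  by have /eqP := fxy i; rewrite addn_eq0 => /andP[].
Qed.

Definition forget_unit_obj (M : Semb1) : CMon :=
  exist _ (swu_monoid M) (simplicial_conical (swu_simplicial M)).
Definition forget_unit_map (M N : Semb1) (f : hom M N) :
    hom (forget_unit_obj M) (forget_unit_obj N) :=
  exist _ (sval f) (svalP f).1.1.
Fact forget_unit_map1 M : forget_unit_map (idm M) = idm (forget_unit_obj M).
Proof. exact: sval_inj. Qed.
Fact forget_unit_mapM M N P (g : hom N P) (f : hom M N) :
  forget_unit_map (cmp g f) = cmp (forget_unit_map g) (forget_unit_map f).
Proof. exact: sval_inj. Qed.

Definition forget_unit : functor Semb1 CMon :=
  Functor forget_unit_map1 forget_unit_mapM.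

(* The rings of MathComp are unital, these need not be. *)
HB.mixin Record Zmodule_isRng V of GRing.Zmodule V := {
  rngmul : V -> V -> V;
  rngmulA : associative rngmul;
  rngmulDl : left_distributive rngmul +%R;
  rngmulDr : right_distributive rngmul +%R }.

#[short(type="rngType")]
HB.structure Definition Rng := {V of Zmodule_isRng V & GRing.Zmodule V}.

Infix "**" := rngmul (at level 40, left associativity) : ring_scope.

Section rng_theory.
Variable R : rngType.
Implicit Types x y : R.

Lemma rngmul0r x : 0 ** x = 0.
Proof. by apply: (addIr (0 ** x)); rewrite -rngmulDl !add0r. Qed.

Lemma rngmulr0 x : x ** 0 = 0.
Proof. by apply: (addIr (x ** 0)); rewrite -rngmulDr !add0r. Qed.

Lemma rngmul_suml n (F : 'I_n -> R) x :
  (\sum_(i < n) F i) ** x = \sum_(i < n) F i ** x.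
Proof.
by apply: (big_morph (rngmul^~ x)) => [a b|]; rewrite ?rngmulDl ?rngmul0r.
Qed.

Lemma rngmul_sumr n (F : 'I_n -> R) x :
  x ** (\sum_(i < n) F i) = \sum_(i < n) x ** F i.
Proof. by apply: (big_morph (rngmul x)) => [a b|]; rewrite ?rngmulDr ?rngmulr0. Qed.

End rng_theory.

Definition rng_morphism (R S : rngType) : set (R -> S) :=
  [set f | nmod_morphism f /\ {morph f : x y / x ** y}].

Lemma rng_morphism_id (R : rngType) : rng_morphism (@idfun R).
Proof. by []. Qed.

Lemma rng_morphism_comp (R S T : rngType) (g : S -> T) (f : R -> S) :
  rng_morphism g -> rng_morphism f -> rng_morphism (g \o f).
Proof.
move=> [gD gM] [fD fM]; split; first exact: nmod_morphism_comp.
by move=> x y /=; rewrite fM gM.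
Qed.

Definition Rngs : category := concrete_category rng_morphism_id rng_morphism_comp.

Definition regular (R : rngType) : Prop :=
  forall x : R, exists y : R, x ** y ** x = x.

Definition Reg_obj := {R : rngType | regular R}.

Definition Reg : category :=
  @concrete_category Reg_obj (fun R => sval R)
    (fun R S => @rng_morphism (sval R) (sval S))
    (fun R => rng_morphism_id (sval R))
    (fun R S T g f => @rng_morphism_comp _ _ _ g f).

Definition Reg_to_Rngs_obj (R : Reg) : Rngs := sval R.
Definition Reg_to_Rngs_map (R S : Reg) (f : hom R S) :
    hom (Reg_to_Rngs_obj R) (Reg_to_Rngs_obj S) := f.
Fact Reg_to_Rngs_map1 R : Reg_to_Rngs_map (idm R) = idm (Reg_to_Rngs_obj R).
Proof. by []. Qed.
Fact Reg_to_Rngs_mapM R S T (g : hom S T) (f : hom R S) :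
  Reg_to_Rngs_map (cmp g f) = cmp (Reg_to_Rngs_map g) (Reg_to_Rngs_map f).
Proof. by []. Qed.

Definition Reg_to_Rngs : functor Reg Rngs :=
  Functor Reg_to_Rngs_map1 Reg_to_Rngs_mapM.

Definition bounded_by (R : rngType) n (a : nat -> nat -> R) : Prop :=
  forall i j, (n <= i)%N || (n <= j)%N -> a i j = 0.

Definition finite_mx (R : rngType) (a : nat -> nat -> R) : bool :=
  `[< exists n, bounded_by n a >].

(* The union over n of the rings of n x n matrices over [R], each of which is
   identified with the matrices vanishing outside of the upper left n x n
   corner. *)
Record Minf (R : rngType) := MkMinf {
  mxcoef :> nat -> nat -> R;
  mxcoef_finite : finite_mx mxcoef }.

Section Minf.
Variable R : rngType.
Local Notation M := (Minf R).
Implicit Types a b c : M.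

Lemma MinfP a b : (forall i j, a i j = b i j) -> a = b.
Proof.
case: a b => a afin [b bfin] /= ab.
have ? : a = b by apply/funext => i; apply/funext => j.
by subst b; congr MkMinf; exact: bool_irrelevance.
Qed.

Lemma Minf_bound a : exists n, bounded_by n a.
Proof. exact/asboolP/mxcoef_finite. Qed.

Lemma bounded_byW n m (a : nat -> nat -> R) :
  (n <= m)%N -> bounded_by n a -> bounded_by m a.
Proof.
by move=> nm an i j mij; apply: an; case/orP: mij => /(leq_trans nm) ->;
  rewrite ?orbT.
Qed.

Lemma Minf_bound2 a b : exists n, bounded_by n a /\ bounded_by n b.
Proof.
have [[n an] [m bm]] := (Minf_bound a, Minf_bound b).
by exists (maxn n m); split; [apply: bounded_byW an|apply: bounded_byW bm];
  rewrite ?leq_maxl ?leq_maxr.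
Qed.

Lemma Minf_bound3 a b c :
  exists n, [/\ bounded_by n a, bounded_by n b & bounded_by n c].
Proof.
have [[n [an bn]] [m cm]] := (Minf_bound2 a b, Minf_bound c).
by exists (maxn n m); split; [apply: bounded_byW an|apply: bounded_byW bn|
  apply: bounded_byW cm]; rewrite ?leq_maxl ?leq_maxr.
Qed.

Lemma fsum_bound (F : nat -> R) n : (forall k, (n <= k)%N -> F k = 0) ->
  \sum_(k \in [set: nat]) F k = \sum_(k < n) F k.
Proof.
move=> F0; rewrite fsbig_ord; apply/esym/fsbig_widen => // k [_ /= /negP].
by rewrite -leqNgt; exact: F0.
Qed.

Fact Minf0_finite : finite_mx (fun _ _ => 0 : R).
Proof. by apply/asboolP; exists 0%N. Qed.
Definition Minf0 := MkMinf Minf0_finite.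

Fact Minf_add_finite a b : finite_mx (fun i j => a i j + b i j).
Proof.
have [n [an bn]] := Minf_bound2 a b.
by apply/asboolP; exists n => i j nij; rewrite an // bn // addr0.
Qed.
Definition Minf_add a b := MkMinf (Minf_add_finite a b).

Fact Minf_opp_finite a : finite_mx (fun i j => - a i j).
Proof.
have [n an] := Minf_bound a.
by apply/asboolP; exists n => i j nij; rewrite an // oppr0.
Qed.
Definition Minf_opp a := MkMinf (Minf_opp_finite a).

Definition mulcoef (a b : nat -> nat -> R) i j : R :=
  \sum_(k \in [set: nat]) a i k ** b k j.

Lemma mulcoefE n (a b : nat -> nat -> R) i j :
  bounded_by n a -> mulcoef a b i j = \sum_(k < n) a i k ** b k j.
Proof. by move=> an; apply: fsum_bound => k nk; rewrite an ?nk ?orbT ?rngmul0r. Qed.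

Lemma mulcoef_bounded n (a b : nat -> nat -> R) :
  bounded_by n a -> bounded_by n b -> bounded_by n (mulcoef a b).
Proof.
move=> an bn i j nij; rewrite (mulcoefE _ _ _ an) big1 // => k _.
by case/orP: nij => nij; [rewrite an ?nij ?rngmul0r|
  rewrite bn ?nij ?orbT ?rngmulr0].
Qed.

Fact Minf_mul_finite a b : finite_mx (mulcoef a b).
Proof.
have [n [an bn]] := Minf_bound2 a b.
by apply/asboolP; exists n; exact: mulcoef_bounded.
Qed.
Definition Minf_mul a b := MkMinf (Minf_mul_finite a b).

HB.instance Definition _ := gen_eqMixin M.
HB.instance Definition _ := gen_choiceMixin M.

Fact Minf_addA : associative Minf_add.
Proof. by move=> a b c; apply: MinfP => i j /=; rewrite addrA. Qed.
Fact Minf_addC : commutative Minf_add.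
Proof. by move=> a b; apply: MinfP => i j /=; rewrite addrC. Qed.
Fact Minf_add0 : left_id Minf0 Minf_add.
Proof. by move=> a; apply: MinfP => i j /=; rewrite add0r. Qed.
Fact Minf_addN : left_inverse Minf0 Minf_opp Minf_add.
Proof. by move=> a; apply: MinfP => i j /=; rewrite addNr. Qed.

HB.instance Definition _ :=
  GRing.isZmodule.Build M Minf_addA Minf_addC Minf_add0 Minf_addN.

Fact Minf_mulA : associative Minf_mul.
Proof.
move=> a b c; apply: MinfP => i j /=.
have [n [an bn cn]] := Minf_bound3 a b c.
rewrite (mulcoefE _ _ _ an) (mulcoefE _ _ _ (mulcoef_bounded an bn)).
under eq_bigr do rewrite (mulcoefE _ _ _ bn) rngmul_sumr.
under [RHS]eq_bigr do rewrite (mulcoefE _ _ _ an) rngmul_suml.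
rewrite exchange_big /=; apply: eq_bigr => k _; apply: eq_bigr => l _.
by rewrite rngmulA.
Qed.

Fact Minf_mulDl : left_distributive Minf_mul +%R.
Proof.
move=> a b c; apply: MinfP => i j /=.
have [n [an bn cn]] := Minf_bound3 a b c.
have abn : bounded_by n (a + b) by move=> k l nkl /=; rewrite an // bn // addr0.
rewrite !(mulcoefE (n := n)) // -big_split /=; apply: eq_bigr => k _.
by rewrite rngmulDl.
Qed.

Fact Minf_mulDr : right_distributive Minf_mul +%R.
Proof.
move=> a b c; apply: MinfP => i j /=; have [n an] := Minf_bound a.
rewrite !(mulcoefE (n := n)) // -big_split /=; apply: eq_bigr => k _.
by rewrite rngmulDr.
Qed.

HB.instance Definition _ :=
  Zmodule_isRng.Build M Minf_mulA Minf_mulDl Minf_mulDr.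

Lemma Minf_coef0 i j : (0 : M) i j = 0. Proof. by []. Qed.
Lemma Minf_coefD a b i j : (a + b) i j = a i j + b i j. Proof. by []. Qed.
Lemma Minf_coefM n a b i j : bounded_by n a ->
  (a ** b) i j = \sum_(k < n) a i k ** b k j.
Proof. exact: mulcoefE. Qed.

End Minf.

Section Minf_map.
Variables (R S : rngType) (f : R -> S).
Hypothesis f_morph : rng_morphism f.

Fact Minf_map_finite (a : Minf R) : finite_mx (fun i j => f (a i j)).
Proof.
have [n an] := Minf_bound a.
by apply/asboolP; exists n => i j nij; rewrite an // f_morph.1.1.
Qed.

Definition Minf_map (a : Minf R) : Minf S := MkMinf (Minf_map_finite a).

Lemma Minf_map_morph : rng_morphism Minf_map.
Proof.
split; first split=> [|a b]; first by apply: MinfP => i j; exact: f_morph.1.1.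
  by apply: MinfP => i j; exact: f_morph.1.2.
move=> a b; apply: MinfP => i j; have [n an] := Minf_bound a.
have fan : bounded_by n (Minf_map a).
  by move=> k l nkl; rewrite /= an // f_morph.1.1.
rewrite (Minf_coefM _ _ _ fan) /= (mulcoefE _ _ _ an).
rewrite (big_morph f f_morph.1.2 f_morph.1.1).
by apply: eq_bigr => k _; rewrite f_morph.2.
Qed.

End Minf_map.

Section idempotents.
Variable R : rngType.
Implicit Types a b c : R.

Definition idem := {a : R | a ** a == a}.

Lemma idemP (e : idem) : val e ** val e = val e.
Proof. by case: e => a /= /eqP. Qed.

Definition idem_equiv a b : Prop := exists x y, a = x ** y /\ b = y ** x.

Lemma idem_equiv_refl (e : idem) : idem_equiv (val e) (val e).
Proof. by exists (val e), (val e); rewrite idemP. Qed.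

Lemma idem_equiv_sym a b : idem_equiv a b -> idem_equiv b a.
Proof. by case=> x [y [-> ->]]; exists y, x. Qed.

Lemma idem_equiv_trans a b c : a ** a = a -> c ** c = c ->
  idem_equiv a b -> idem_equiv b c -> idem_equiv a c.
Proof.
move=> aa cc [x [y [axy byx]]] [u [v [buv cvu]]].
exists (x ** u), (v ** y); split.
  by rewrite -aa axy -!rngmulA (rngmulA y) -byx buv !rngmulA.
by rewrite -cc cvu -!rngmulA (rngmulA u) -buv byx !rngmulA.
Qed.

(* If a = x y and b = y x are idempotent, then x and y can be chosen in a R b
   and b R a, respectively. *)
Lemma idem_equiv_norm a b : a ** a = a -> b ** b = b -> idem_equiv a b ->
  exists x y, [/\ a = x ** y, b = y ** x,
    a ** x = x /\ x ** b = x & b ** y = y /\ y ** a = y].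
Proof.
move=> aa bb [x [y [axy byx]]].
have axb : a ** x = x ** b by rewrite axy byx rngmulA.
have bya : b ** y = y ** a by rewrite axy byx rngmulA.
exists (a ** x), (b ** y); split.
- rewrite axb -rngmulA (rngmulA b) bb bya rngmulA -axy.
  by rewrite aa.
- rewrite bya -rngmulA (rngmulA a) aa axb rngmulA -byx.
  by rewrite bb.
- by rewrite rngmulA aa axb -rngmulA bb.
- by rewrite rngmulA bb bya -rngmulA aa.
Qed.

Lemma idem_equivD a b a' b' :
  a ** a = a -> b ** b = b -> a' ** a' = a' -> b' ** b' = b' ->
  a ** b = 0 -> b ** a = 0 -> a' ** b' = 0 -> b' ** a' = 0 ->
  idem_equiv a a' -> idem_equiv b b' -> idem_equiv (a + b) (a' + b').
Proof.
move=> aa bb aa' bb' ab ba ab' ba' /idem_equiv_norm[] // x [y].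
move=> [axy ayx [ax xa'] [a'y ya]] /idem_equiv_norm[] // u [v].
move=> [buv bvu [bu ub'] [b'v vb]]; exists (x + u), (y + v).
have xv : x ** v = 0 by rewrite -xa' -b'v -rngmulA (rngmulA a') ab' rngmul0r rngmulr0.
have uy : u ** y = 0 by rewrite -ub' -a'y -rngmulA (rngmulA b') ba' rngmul0r rngmulr0.
have yu : y ** u = 0 by rewrite -ya -bu -rngmulA (rngmulA a) ab rngmul0r rngmulr0.
have vx : v ** x = 0 by rewrite -vb -ax -rngmulA (rngmulA b) ba rngmul0r rngmulr0.
by rewrite !rngmulDl !rngmulDr xv uy yu vx !(addr0, add0r) -axy -ayx -buv -bvu.
Qed.

Lemma idemD a b : a ** a = a -> b ** b = b -> a ** b = 0 -> b ** a = 0 ->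
  (a + b) ** (a + b) == a + b.
Proof.
by move=> aa bb ab ba; rewrite rngmulDl !rngmulDr aa bb ab ba addr0 add0r.
Qed.

Lemma idem0_subproof : 0 ** 0 == 0 :> R. Proof. by rewrite rngmul0r. Qed.
Definition idem0 : idem := exist _ 0 idem0_subproof.

Definition idem_rel : rel idem := fun e e' => `[< idem_equiv (val e) (val e') >].

Fact idem_rel_refl : reflexive idem_rel.
Proof. by move=> a; apply/asboolP/idem_equiv_refl. Qed.
Fact idem_rel_sym : symmetric idem_rel.
Proof. by move=> a b; apply/asboolP/asboolP; exact: idem_equiv_sym. Qed.
Fact idem_rel_trans : transitive idem_rel.
Proof.
move=> b a c /asboolP ab /asboolP bc; apply/asboolP.
by apply: idem_equiv_trans ab bc; exact: idemP.
Qed.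

Canonical idem_rel_equiv := EquivRel idem_rel idem_rel_refl idem_rel_sym idem_rel_trans.

End idempotents.

Lemma rng_morphism_idem (R S : rngType) (f : R -> S) (a : idem R) :
  rng_morphism f -> f (val a) ** f (val a) == f (val a).
Proof. by move=> [_ fM]; rewrite -fM idemP. Qed.

Lemma rng_morphism_idem_equiv (R S : rngType) (f : R -> S) a b :
  rng_morphism f -> idem_equiv a b -> idem_equiv (f a) (f b).
Proof. by move=> [_ fM] [x [y [-> ->]]]; exists (f x), (f y); rewrite !fM. Qed.

(* Two orthogonal copies of Minf R inside itself: [spread d a] is [a] with the
   index i replaced by 2i + d. Every idempotent is equivalent to its copies. *)
Section spread.
Variable R : rngType.
Implicit Types (a b : Minf R) (d : bool).

Definition half (d : bool) (i : nat) : option nat :=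
  if odd i == d then Some i./2 else None.

Definition reidx_coef (f g : nat -> option nat) (a : nat -> nat -> R) i j : R :=
  if f i is Some k then (if g j is Some l then a k l else 0) else 0.

Definition tame (f : nat -> option nat) := f = Some \/ exists d, f = half d.

Lemma tame_bound f n i k : tame f -> f i = Some k -> (n.*2 <= i)%N -> (n <= k)%N.
Proof.
case=> [->|[d ->]]; first by case=> <-; apply: leq_trans; rewrite -addnn leq_addr.
by rewrite /half; case: eqP => // _ [<-] /half_leq; rewrite doubleK.
Qed.

Lemma reidx_bounded f g n a : tame f -> tame g -> bounded_by n a ->
  bounded_by n.*2 (reidx_coef f g a).
Proof.
move=> tf tg an i j ij; rewrite /reidx_coef.
case fi: (f i) => [k|] //; case gj: (g j) => [l|] //; apply: an.
by case/orP: ij => ij; rewrite ?(tame_bound tf fi ij) ?(tame_bound tg gj ij) ?orbT.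
Qed.

Fact spread_finite d a : finite_mx (reidx_coef (half d) (half d) a).
Proof.
have [n an] := Minf_bound a; apply/asboolP; exists n.*2.
by apply: reidx_bounded => //; right; exists d.
Qed.
Definition spread d a : Minf R := MkMinf (spread_finite d a).

Lemma sum_half d n (F : nat -> R) :
  \sum_(k < n.*2) (if half d k is Some l then F l else 0) = \sum_(k < n) F k.
Proof.
elim: n => [|n IH]; first by rewrite !big_ord0.
rewrite doubleS !big_ord_recr /= IH /half /= odd_double uphalf_double doubleK.
by case: d {IH}; rewrite /= ?addr0 ?add0r.
Qed.

Lemma sum_tame f n (F : nat -> R) : tame f -> (forall k, (n <= k)%N -> F k = 0) ->
  \sum_(k < n.*2) (if f k is Some l then F l else 0) = \sum_(k < n) F k.
Proof.
case=> [->|[d ->]] F0; last exact: sum_half.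
rewrite -(big_mkord xpredT) -(big_mkord xpredT F) /=.
rewrite (@big_cat_nat _ _ _ n) ?leq0n //=; last by rewrite -addnn leq_addr.
rewrite [X in _ + X]big_nat_cond [X in _ + X]big1 ?addr0 // => i.
by rewrite andbT => /andP[+ _]; exact: F0.
Qed.

Lemma reidx_mul f h g a b i j : tame f -> tame h -> tame g ->
  mulcoef (reidx_coef f h a) (reidx_coef h g b) i j =
  reidx_coef f g (mulcoef a b) i j.
Proof.
move=> tf th tg; have [n an] := Minf_bound a.
rewrite (mulcoefE _ _ _ (reidx_bounded tf th an)) /reidx_coef.
case fi: (f i) => [k|]; last by rewrite big1 // => ? _; rewrite rngmul0r.
case gj: (g j) => [l|]; last first.
  by rewrite big1 // => m _; case: (h m) => [?|] /=; rewrite rngmulr0.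
rewrite (mulcoefE _ _ _ an) -(@sum_tame h n (fun m => a k m ** b m l)) //; last first.
  by move=> m nm; rewrite an ?nm ?orbT ?rngmul0r.
by apply: eq_bigr => m _; case: (h m) => [?|] /=; rewrite ?rngmul0r.
Qed.

Lemma tame_half d : tame (half d). Proof. by right; exists d. Qed.
Lemma tame_some : tame Some. Proof. by left. Qed.
#[local] Hint Resolve tame_half tame_some : core.

Lemma spread_morph d : rng_morphism (spread d).
Proof.
split; last by move=> a b; apply: MinfP => i j; rewrite /= reidx_mul.
split=> [|a b]; apply: MinfP => i j /=; rewrite /reidx_coef.
  by case: (half d i) => // k; case: (half d j).
by case: (half d i) => [k|]; case: (half d j) => [l|]; rewrite /= ?addr0.
Qed.

Lemma spread_orth d a b : spread d a ** spread (~~ d) b = 0.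
Proof.
apply: MinfP => i j; have [n an] := Minf_bound (spread d a).
rewrite (Minf_coefM _ _ _ an) big1 // => k _ /=; rewrite /reidx_coef.
case: (half d i) => [l|]; last by rewrite rngmul0r.
by rewrite /half; case: d {an} => /=; case: (odd k) => /=;
  rewrite ?rngmulr0 ?rngmul0r.
Qed.

Lemma spread_equiv d (a : idem (Minf R)) : idem_equiv (val a) (spread d (val a)).
Proof.
case: a => /= a /eqP aa.
have fin f g : tame f -> tame g -> finite_mx (reidx_coef f g a).
  move=> tf tg; have [n an] := Minf_bound a.
  by apply/asboolP; exists n.*2; exact: reidx_bounded.
exists (MkMinf (fin _ _ tame_some (tame_half d))).
exists (MkMinf (fin _ _ (tame_half d) tame_some)).
by split; apply: MinfP => i j; rewrite /= reidx_mul // -{1}aa.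
Qed.

End spread.

Definition idem_map (R S : rngType) (f : R -> S) (fM : rng_morphism f)
    (a : idem R) : idem S :=
  exist _ (f (val a)) (rng_morphism_idem a fM).

Definition V_monoid (R : rngType) := {eq_quot @idem_rel (Minf R)}.

Section V_monoid.
Variable R : rngType.
Local Notation M := (Minf R).
Implicit Types (a b c : idem M) (u v w : V_monoid R).

HB.instance Definition _ := Choice.on (V_monoid R).

Definition Vclass a : V_monoid R := \pi_({eq_quot @idem_rel M}) a.

Definition Vrepr u : idem M := repr u.

Lemma VreprK u : Vclass (Vrepr u) = u.
Proof. exact: reprK. Qed.

Lemma VclassP a b : Vclass a = Vclass b <-> idem_equiv (val a) (val b).
Proof.
split; first by move/eqmodP/asboolP.
by move=> ab; apply/eqmodP/asboolP.
Qed.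

Definition spread_idem d a : idem M := idem_map (spread_morph R d) a.

Lemma Vclass_spread d a : Vclass (spread_idem d a) = Vclass a.
Proof. by apply/esym/VclassP; exact: spread_equiv. Qed.

Fact Vsum_subproof a b :
  (spread false (val a) + spread true (val b)) **
  (spread false (val a) + spread true (val b)) ==
  spread false (val a) + spread true (val b).
Proof.
apply: idemD.
- exact: (idemP (spread_idem false a)).
- exact: (idemP (spread_idem true b)).
- exact: (spread_orth false).
- exact: (spread_orth true).
Qed.

Definition Vsum a b : idem M :=
  exist _ (spread false (val a) + spread true (val b)) (Vsum_subproof a b).

Definition V_zero : V_monoid R := Vclass (idem0 M).

Definition V_add u v : V_monoid R := Vclass (Vsum (Vrepr u) (Vrepr v)).

(* The property that determines the addition of V(R). *)
Lemma V_addE a b c : val a ** val b = 0 -> val b ** val a = 0 ->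
  val c = val a + val b -> V_add (Vclass a) (Vclass b) = Vclass c.
Proof.
move=> ab ba cab; apply/VclassP; rewrite cab /=.
have ha d a' : idem_equiv (spread d (val (Vrepr (Vclass a')))) (val a').
  by apply/(VclassP (spread_idem d _) a'); rewrite Vclass_spread VreprK.
apply: idem_equivD => //; try exact: idemP.
- exact: (idemP (spread_idem false _)).
- exact: (idemP (spread_idem true _)).
- exact: (spread_orth false).
- exact: (spread_orth true).
- exact: ha.
- exact: ha.
Qed.

Lemma V_add_class a b : V_add (Vclass a) (Vclass b) = Vclass (Vsum a b).
Proof.
rewrite -(Vclass_spread false a) -(Vclass_spread true b); apply: V_addE => //.
- exact: (spread_orth false).
- exact: (spread_orth true).
Qed.

Fact V_addC : commutative V_add.
Proof.
move=> u v; rewrite -(VreprK u) -(VreprK v) V_add_class.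
rewrite -(Vclass_spread true (Vrepr v)) -(Vclass_spread false (Vrepr u)).
apply/esym/V_addE; [exact: (spread_orth true)|exact: (spread_orth false)|].
by rewrite /= addrC.
Qed.

Fact V_add0 : left_id V_zero V_add.
Proof.
move=> u; rewrite -(VreprK u); apply: V_addE => /=.
- exact: rngmul0r.
- exact: rngmulr0.
- by rewrite add0r.
Qed.

Fact V_addA : associative V_add.
Proof.
move=> u v w; rewrite -(VreprK u) -(VreprK v) -(VreprK w).
move: (Vrepr u) (Vrepr v) (Vrepr w) => a b c.
rewrite (V_add_class b c) (V_add_class a (Vsum b c)) (V_add_class a b).
pose B := spread_idem true (spread_idem false b).
pose C := spread_idem true (spread_idem true c).
have -> : Vclass (Vsum a b) = Vclass (Vsum a (spread_idem false b)).
  by rewrite -!V_add_class Vclass_spread.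
have <- : Vclass C = Vclass c by rewrite !Vclass_spread.
apply/esym/V_addE => /=.
- rewrite rngmulDl (spread_orth false) -(spread_morph R true).2.
  by rewrite (spread_orth false) (spread_morph R true).1.1 addr0.
- rewrite rngmulDr (spread_orth true) -(spread_morph R true).2.
  by rewrite (spread_orth true) (spread_morph R true).1.1 addr0.
- by rewrite (spread_morph R true).1.2 addrA.
Qed.

HB.instance Definition _ := GRing.isNmodule.Build (V_monoid R) V_addA V_addC V_add0.

Lemma V_conical : conical (V_monoid R).
Proof.
suff h u v : u + v = 0 -> u = 0.
  by move=> u v uv; split; [exact: h uv|apply: (h v u); rewrite addrC].
rewrite -(VreprK u) -(VreprK v); move: (Vrepr u) (Vrepr v) => a b.
rewrite [X in X = _]V_add_class => /VclassP[x [y /= [xy yx]]].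
suff ab0 : spread false (val a) + spread true (val b) = 0.
  have a0 : val a = 0.
    apply: MinfP => i j; have := congr1 (fun m : M => m i.*2 j.*2) ab0.
    by rewrite /= /reidx_coef /half !odd_double /= !doubleK addr0.
  by congr (Vclass _); apply: val_inj.
have := eqP (Vsum_subproof a b); rewrite {1 2}xy => <-.
by rewrite -rngmulA (rngmulA y) -yx rngmul0r rngmulr0.
Qed.

End V_monoid.

Section V_map.
Variables (R S : rngType) (f : R -> S) (fM : rng_morphism f).

Definition V_map (u : V_monoid R) : V_monoid S :=
  Vclass (idem_map (Minf_map_morph fM) (Vrepr u)).

Lemma V_mapE (a : idem (Minf R)) :
  V_map (Vclass a) = Vclass (idem_map (Minf_map_morph fM) a).
Proof.
apply/VclassP; apply: rng_morphism_idem_equiv; first exact: Minf_map_morph.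
by apply/VclassP; rewrite VreprK.
Qed.

Lemma Minf_map_spread d (a : Minf R) :
  Minf_map fM (spread d a) = spread d (Minf_map fM a).
Proof.
apply: MinfP => i j /=; rewrite /reidx_coef.
case: (half d i) => [k|]; last exact: fM.1.1.
by case: (half d j) => [l|] //; exact: fM.1.1.
Qed.

Lemma V_map_morph : nmod_morphism V_map.
Proof.
have [[f0 fD] fMM] := Minf_map_morph fM.
split=> [|u v].
  by rewrite [LHS]V_mapE; congr (Vclass _); apply: val_inj.
rewrite -(VreprK u) -(VreprK v) [in LHS]/GRing.add /= V_add_class !V_mapE.
rewrite [RHS]V_add_class; congr (Vclass _); apply: val_inj; rewrite /= fD.
by rewrite !Minf_map_spread.
Qed.

End V_map.

Definition V_obj (R : Rngs) : CMon := exist conical (V_monoid R) (V_conical (R := R)).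
Definition V_mor (R S : Rngs) (f : hom R S) : hom (V_obj R) (V_obj S) :=
  exist _ (V_map (svalP f)) (V_map_morph (svalP f)).
Fact V_mor1 R : V_mor (idm R) = idm (V_obj R).
Proof.
apply: sval_inj; apply/funext => u; rewrite /= -{2}(VreprK u).
by congr (Vclass _); apply: val_inj; apply: MinfP.
Qed.
Fact V_morM R S T (g : hom S T) (f : hom R S) :
  V_mor (cmp g f) = cmp (V_mor g) (V_mor f).
Proof.
apply: sval_inj; apply/funext => u; rewrite -(VreprK u) /= !V_mapE.
by congr (Vclass _); apply: val_inj; apply: MinfP.
Qed.

Definition V : functor Rngs CMon := Functor V_mor1 V_morM.

(* Complex Banach algebras with an isometric conjugate-linear involution; the
   norm takes values in R[i], where z <= t means that t - z is real and
   nonnegative. *)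
HB.mixin Record CompleteNormedModule_isCStarAlgebra (R : realType) A
    of Rng A & CompleteNormedModule R[i] A := {
  rngmulZl : forall (k : R[i]) (x y : A), (k *: x) ** y = k *: (x ** y);
  rngmulZr : forall (k : R[i]) (x y : A), x ** (k *: y) = k *: (x ** y);
  rngmul_norm : forall x y : A, `|x ** y| <= `|x| * `|y|;
  star : A -> A;
  starK : involutive star;
  starD : {morph star : x y / x + y};
  starZ : forall (k : R[i]) (x : A), star (k *: x) = conjc k *: star x;
  starM : forall x y : A, star (x ** y) = star y ** star x;
  cstar_norm : forall x : A, `|star x ** x| = `|x| ^+ 2 }.

#[short(type="cstarAlgType")]
HB.structure Definition CStarAlgebra (R : realType) :=
  {A of CompleteNormedModule_isCStarAlgebra R A & Rng A
      & CompleteNormedModule R[i] A}.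

Definition cstar_morphism (R : realType) (A B : cstarAlgType R) : set (A -> B) :=
  [set f | [/\ rng_morphism f, scalable f & {morph f : x / star x}]].

Lemma cstar_morphism_id (R : realType) (A : cstarAlgType R) :
  cstar_morphism (@idfun A).
Proof. by []. Qed.

Lemma cstar_morphism_comp (R : realType) (A B C : cstarAlgType R)
    (g : B -> C) (f : A -> B) :
  cstar_morphism g -> cstar_morphism f -> cstar_morphism (g \o f).
Proof.
move=> [gM gZ gS] [fM fZ fS]; split=> [|k x|x] /=.
- exact: rng_morphism_comp.
- by rewrite fZ gZ.
- by rewrite fS gS.
Qed.

Definition rng_unit (R : rngType) (e : R) : Prop :=
  forall x : R, e ** x = x /\ x ** e = x.

Definition invertible_sa_dense (T : topologicalType) (mul : T -> T -> T)
    (star : T -> T) (one : T) : Prop :=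
  [set x | star x = x] `<=`
  closure [set x | star x = x /\ exists y, mul x y = one /\ mul y x = one].

Section real_rank0.
Variables (R : realType) (A : cstarAlgType R).

Definition unitization := (A * (R[i])^o)%type.

Definition unitization_mul (x y : unitization) : unitization :=
  (x.1 ** y.1 + x.2 *: y.1 + y.2 *: x.1, x.2 * y.2).

Definition unitization_star (x : unitization) : unitization :=
  (star x.1, conjc x.2).

Definition unitization_one : unitization := (0, 1).

(* Brown and Pedersen: a unital A has real rank 0 if its invertible self-adjoint
   elements are dense among the self-adjoint ones, and a nonunital A has real
   rank 0 if its unitization has. The C*-norm of the unitization induces the
   product topology, since A is a closed subspace of codimension 1 in it. *)
Definition real_rank0 : Prop :=
  (forall e : A, rng_unit e -> invertible_sa_dense rngmul star e) /\
  ((~ exists e : A, rng_unit e) ->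
    invertible_sa_dense unitization_mul unitization_star unitization_one).

End real_rank0.

Definition RR0_obj (R : realType) := {A : cstarAlgType R | real_rank0 A}.

Definition RR0 (R : realType) : category :=
  @concrete_category (RR0_obj R) (fun A => sval A)
    (fun A B => @cstar_morphism R (sval A) (sval B))
    (fun A => cstar_morphism_id (sval A))
    (fun A B C g f => @cstar_morphism_comp R _ _ _ g f).

Section RR0_to_Rngs.
Variable R : realType.

Definition RR0_to_Rngs_obj (A : RR0 R) : Rngs := sval A.
Definition RR0_to_Rngs_map (A B : RR0 R) (f : hom A B) :
    hom (RR0_to_Rngs_obj A) (RR0_to_Rngs_obj B) :=
  exist _ (sval f) (let: And3 fM _ _ := svalP f in fM).
Fact RR0_to_Rngs_map1 A : RR0_to_Rngs_map (idm A) = idm (RR0_to_Rngs_obj A).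
Proof. exact: sval_inj. Qed.
Fact RR0_to_Rngs_mapM A B C (g : hom B C) (f : hom A B) :
  RR0_to_Rngs_map (cmp g f) = cmp (RR0_to_Rngs_map g) (RR0_to_Rngs_map f).
Proof. exact: sval_inj. Qed.

Definition RR0_to_Rngs : functor (RR0 R) Rngs :=
  Functor RR0_to_Rngs_map1 RR0_to_Rngs_mapM.

End RR0_to_Rngs.

(* Main.v *)
(* Let e generate V(Gamma(N,1)), the monoid of the initial nonzero object. Send e
   to P = (N^2,(1,1)) and split it there as a + a' along the two coordinates.
   Two maps g, g' : P -> Q = (N^4,(1,1,1,1)) make the rows and the columns of a
   2 x 2 array from these coordinates. In Gamma(Q) the classes of g(a) and g(a')
   have no common nonzero lower bound, so g(a) commutes with everything below
   the image of e, in particular with g'(a), and the class of g(a) g'(a) can only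
   be the upper left unit vector e_00 of N^4. There are f, f' : Q -> (N^5,(2,...,2))
   with f g = f' g and f g' = f' g', hence f(g(a) g'(a)) = f'(g(a) g'(a)), although
   f(e_00) <> f'(e_00).

   All that is used of the rings Gamma(X) is that every nonzero z has a multiple
   r z s that is a nonzero idempotent. In a C*-algebra of real rank 0, take h
   proportional to z^* z and a self-adjoint k close to h for which 1 - k and
   1 + k are invertible. Then 1 is a gap in the spectrum of k^2, and the spectral
   projection p of k^2 beyond the gap is a multiple p h^2 s. The functional
   calculus needed reduces to the fixed points of z = (y + z^2) / 2, which are
   square roots of 1 - y for norm y < 1. *)
Require Import Defs.
From HB Require Import structures.
From mathcomp Require Import all_boot all_order all_algebra.
From mathcomp Require Import all_classical all_reals all_analysis.
From mathcomp Require Import complex ring lra.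

Set Implicit Arguments.
Unset Strict Implicit.
Unset Printing Implicit Defensive.

(* MathComp shadows some names of Defs, such as hom and fmap. *)
Import Order.TTheory GRing.Theory Num.Theory Defs numFieldNormedType.Exports.
Local Open Scope ring_scope.
Local Open Scope complex_scope.

(** * Idempotents and V *)

Definition idem_rich (R : rngType) : Prop :=
  forall z : R, z <> 0 ->
  exists r s, r ** z ** s <> 0 /\ (r ** z ** s) ** (r ** z ** s) = r ** z ** s.

Lemma regular_idem_rich (R : rngType) : regular R -> idem_rich R.
Proof.
(* Without a unit, the idempotent [z ** y] has to be written as the two-sided multiple (z y) z y. *)
move=> reg z z0; have [y zyz] := reg z; exists (z ** y), y.
have E : z ** y ** z ** y = z ** y by rewrite zyz.
rewrite E; split; last by rewrite rngmulA.
by move=> zy0; apply: z0; rewrite -zyz zy0 rngmul0r.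
Qed.

Section rng_signs.
Variable R : rngType.
Implicit Types x y z : R.

Lemma rngmulrN x y : x ** (- y) = - (x ** y).
Proof. by apply: (addrI (x ** y)); rewrite -rngmulDr !subrr rngmulr0. Qed.

Lemma rngmulNr x y : (- x) ** y = - (x ** y).
Proof. by apply: (addrI (x ** y)); rewrite -rngmulDl !subrr rngmul0r. Qed.

Lemma rngmulBr x y z : x ** (y - z) = x ** y - x ** z.
Proof. by rewrite rngmulDr rngmulrN. Qed.

Lemma rngmulBl x y z : (x - y) ** z = x ** z - y ** z.
Proof. by rewrite rngmulDl rngmulNr. Qed.

End rng_signs.

(** * Matrices with a single nonzero entry *)

Section matrix_unit.
Variable R : rngType.

Fact elem_finite (a : R) i j :
  finite_mx (fun k l => if (k == i) && (l == j) then a else 0).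
Proof.
apply/asboolP; exists (maxn i j).+1 => k l.
case: eqP => [->|_] //=; case: eqP => [->|_] //=.
by rewrite !ltnNge leq_maxl leq_maxr.
Qed.
Definition elem (a : R) i j : Minf R := MkMinf (elem_finite a i j).

Lemma elem_mull (a : R) i j (y : Minf R) k l :
  (elem a i j ** y) k l = if k == i then a ** y j l else 0.
Proof.
have [n [yn an]] := Minf_bound2 y (elem a i j).
rewrite (Minf_coefM _ _ _ an) /=; case: (k == i) => /=; last first.
  by rewrite big1 // => h _; rewrite rngmul0r.
have [jn|nj] := ltnP j n; last first.
  rewrite yn ?nj // rngmulr0 big1 // => h _.
  by rewrite ltn_eqF ?rngmul0r // (leq_trans (ltn_ord h)).
rewrite (bigD1 (Ordinal jn)) //= eqxx big1 ?addr0 // => h /eqP hj.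
by rewrite ifN ?rngmul0r //; apply/eqP => hj'; apply: hj; apply: val_inj.
Qed.

Lemma elem_mulr (a : R) i j (y : Minf R) k l :
  (y ** elem a i j) k l = if l == j then y k i ** a else 0.
Proof.
have [n yn] := Minf_bound y.
rewrite (Minf_coefM _ _ _ yn) /=; case: (l == j) => /=; last first.
  by rewrite big1 // => h _; rewrite andbF rngmulr0.
have [jn|nj] := ltnP i n; last first.
  rewrite yn ?nj ?orbT // rngmul0r big1 // => h _.
  by rewrite ltn_eqF ?rngmulr0 // (leq_trans (ltn_ord h)).
rewrite (bigD1 (Ordinal jn)) //= eqxx big1 ?addr0 // => h /eqP hj.
by rewrite andbT ifN ?rngmulr0 //; apply/eqP => hj'; apply: hj; apply: val_inj.
Qed.

Lemma elem_mul (a b : R) i j k l (y : Minf R) :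
  elem a i j ** y ** elem b k l = elem (a ** y j k ** b) i l.
Proof.
apply: MinfP => m n; rewrite elem_mulr elem_mull /=.
by case: (m == i); case: (n == l); rewrite //= rngmul0r.
Qed.

Lemma elem_idem (p : R) i : p ** p = p -> elem p i i ** elem p i i = elem p i i.
Proof.
move=> pp; apply: MinfP => m n; rewrite elem_mull /= eqxx /=.
by case: (m == i); case: (n == i); rewrite //= rngmulr0.
Qed.

End matrix_unit.

(** * Order, splitting and refinement of classes in V *)

Section V_facts.
Variable R : rngType.
Local Notation M := (Minf R).
Implicit Types a b e : M.

Definition mkidem (T : rngType) (a : T) (aa : a ** a = a) : idem T :=
  exist _ a (introT eqP aa).

Lemma idem_equiv0 (T : rngType) (p : T) : p ** p = p -> idem_equiv p 0 -> p = 0.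
Proof.
move=> pp [x [y [pE yx]]].
by rewrite -pp {1}pE pE -rngmulA (rngmulA y) -yx rngmul0r rngmulr0.
Qed.

Lemma Vclass_eq0 (a : idem M) : Vclass a = 0 -> val a = 0.
Proof. by move/VclassP => a0; apply: idem_equiv0 => //; exact: idemP. Qed.

Lemma Vclass_sub (a f : idem M) : val a ** val f = val f -> val f ** val a = val f ->
  exists2 g : idem M, val g = val a - val f & Vclass a = Vclass f + Vclass g.
Proof.
move=> af fa; have ff := idemP f; have aa := idemP a.
have gg : (val a - val f) ** (val a - val f) = val a - val f.
  by rewrite rngmulBr !rngmulBl aa af fa ff subrr subr0.
exists (mkidem gg) => //; apply/esym/V_addE => /=.
- by rewrite rngmulBr fa ff subrr.
- by rewrite rngmulBl af ff subrr.
- by rewrite addrC subrK.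
Qed.

(** The element [y ** val p ** x] is an idempotent below [a], equivalent to [p] by means of
    [y ** val p] and [val p ** x]. *)
Lemma Vclass_le_factor (p a : idem M) x y :
  val p = x ** y -> x ** val a = x -> val a ** y = y ->
  alg_le (Vclass p) (Vclass a).
Proof.
move=> pE xa ay; have pp := idemP p.
have ff : (y ** val p ** x) ** (y ** val p ** x) = y ** val p ** x.
  rewrite -!rngmulA (rngmulA x) -pE (rngmulA (val p)) pp (rngmulA (val p)).
  by rewrite pp.
have [g _ ->] : exists2 g : idem M, True & Vclass a = Vclass (mkidem ff) + Vclass g.
  by case: (@Vclass_sub a (mkidem ff)) => [||g _ ?]; [
    rewrite /= !rngmulA ay|rewrite /= -!rngmulA xa|exists g].
exists (Vclass g); congr (_ + _); apply/VclassP => /=.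
exists (y ** val p), (val p ** x); split; first by rewrite !rngmulA -(rngmulA y _ (val p)) pp.
by rewrite -rngmulA (rngmulA x) -pE !pp.
Qed.

(** A nonzero entry of a x b has a nonzero idempotent multiple. Moved to the upper left corner, it
    factors through [a] and through [b], so its class would be a nonzero common lower bound. *)
Lemma rich_orthogonal (a b : idem M) x : idem_rich R ->
  (forall w, alg_le w (Vclass a) -> alg_le w (Vclass b) -> w = 0) ->
  val a ** x ** val b = 0.
Proof.
move=> rich ab; apply: contrapT => y0; set y := _ ** _ in y0.
have [i [j yij]] : exists i j, y i j <> 0.
  apply: contrapT => yn; apply: y0; apply: MinfP => i j.
  by apply: contrapT => yij; apply: yn; exists i, j.
have [r [s [p0 pp]]] := rich _ yij.
have PP := elem_idem 0 pp.
pose u := elem r 0 i; pose v := elem s j 0.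
have PE : elem (r ** y i j ** s) 0 0 = u ** y ** v by rewrite elem_mul.
apply: p0; suff /(congr1 (fun m : M => m 0%N 0%N)) : elem (r ** y i j ** s) 0 0 = 0.
  by [].
apply: (@Vclass_eq0 (mkidem PP)); apply: ab.
  apply: (@Vclass_le_factor _ _ (u ** val a) (val a ** x ** val b ** v)).
  - by rewrite /= PE /y -!rngmulA (rngmulA (val a) (val a)) idemP.
  - by rewrite -rngmulA idemP.
  - by rewrite !rngmulA idemP.
apply: (@Vclass_le_factor _ _ (u ** val a ** x ** val b) (val b ** v)).
- by rewrite /= PE /y -!rngmulA (rngmulA (val b) (val b)) idemP.
- by rewrite -!rngmulA idemP.
- by rewrite rngmulA idemP.
Qed.

(** The sum of classes is represented by an orthogonal sum of spread copies. Conjugating by the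
    equivalence [x], [y] brings the copies back under [e], so that [e] itself is split and not only
    its class. *)
Lemma Vclass_split (e : idem M) u v : Vclass e = u + v ->
  exists a b : idem M, [/\ Vclass a = u, Vclass b = v, val e = val a + val b,
    val a ** val b = 0 & val b ** val a = 0].
Proof.
rewrite -(VreprK u) -(VreprK v); move: (Vrepr u) (Vrepr v) => a b.
rewrite [in X in X -> _]/GRing.add /= V_add_class => /VclassP /idem_equiv_norm.
case; [exact: idemP|exact: idemP|move=> x [y [exy sE [ex xs] [sy ye]]]].
move: sE xs sy; rewrite /=; set a' := spread _ _; set b' := spread _ _.
move=> sE xs sy.
have aa : a' ** a' = a' by exact: (idemP (spread_idem false a)).
have bb : b' ** b' = b' by exact: (idemP (spread_idem true b)).
have ab : a' ** b' = 0 by exact: (spread_orth false).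
have ba : b' ** a' = 0 by exact: (spread_orth true).
(* Since y x = a' + b', a product c y x d with c, d among a', b' is just c d. *)
have aya : a' ** y ** x ** a' = a'.
  by rewrite -(rngmulA a') -sE rngmulDr aa ab addr0 aa.
have byb : b' ** y ** x ** b' = b'.
  by rewrite -(rngmulA b') -sE rngmulDr bb ba add0r bb.
have ayb : a' ** y ** x ** b' = 0.
  by rewrite -(rngmulA a') -sE rngmulDr aa ab addr0 ab.
have bya : b' ** y ** x ** a' = 0.
  by rewrite -(rngmulA b') -sE rngmulDr bb ba add0r ba.
have mulE c d : (x ** c ** y) ** (x ** d ** y) = x ** (c ** y ** x ** d) ** y.
  by rewrite !rngmulA.
have aI : (x ** a' ** y) ** (x ** a' ** y) = x ** a' ** y by rewrite mulE aya.
have bI : (x ** b' ** y) ** (x ** b' ** y) = x ** b' ** y by rewrite mulE byb.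
exists (mkidem aI), (mkidem bI); split => /=.
- rewrite -(Vclass_spread false a); apply/VclassP => /=; rewrite -/a'.
  exists (x ** a'), (a' ** y); split; first by rewrite !rngmulA -(rngmulA x _ a') aa.
  by rewrite rngmulA aya.
- rewrite -(Vclass_spread true b); apply/VclassP => /=; rewrite -/b'.
  exists (x ** b'), (b' ** y); split; first by rewrite !rngmulA -(rngmulA x _ b') bb.
  by rewrite rngmulA byb.
- by rewrite -rngmulDl -rngmulDr xs.
- by rewrite mulE ayb rngmulr0 rngmul0r.
- by rewrite mulE bya rngmulr0 rngmul0r.
Qed.

(* Both a x a' and a' x a vanish, so a commutes with every x below a + a'. *)
Lemma Vclass_refine (a a' b b' : idem M) : idem_rich R ->
  val a + val a' = val b + val b' ->
  val a ** val a' = 0 -> val a' ** val a = 0 ->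
  val b ** val b' = 0 -> val b' ** val b = 0 ->
  (forall w, alg_le w (Vclass a) -> alg_le w (Vclass a') -> w = 0) ->
  exists c d : idem M, [/\ val c = val a ** val b,
    Vclass a = Vclass c + Vclass d, alg_le (Vclass c) (Vclass b) &
    alg_le (Vclass d) (Vclass b')].
Proof.
move=> rich eE aa' a'a bb' b'b ort.
have ort' w : alg_le w (Vclass a') -> alg_le w (Vclass a) -> w = 0.
  by move=> ? ?; exact: ort.
have comm (x : M) : (val a + val a') ** x = x -> x ** (val a + val a') = x ->
    val a ** x = x ** val a.
  move=> ex xe; transitivity (val a ** x ** val a).
    rewrite -{1}xe !rngmulDr (rngmulA _ _ (val a')) rich_orthogonal // addr0.
    by rewrite rngmulA.
  rewrite -{2}ex !rngmulDl (rich_orthogonal x rich ort') addr0 //.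
have abC : val a ** val b = val b ** val a.
  by apply: comm; rewrite eE ?rngmulDl ?rngmulDr idemP ?bb' ?b'b addr0.
have ab'C : val a ** val b' = val b' ** val a.
  by apply: comm; rewrite eE ?rngmulDl ?rngmulDr idemP ?bb' ?b'b add0r.
have aE : val a = val a ** val b + val a ** val b'.
  by rewrite -rngmulDr -eE rngmulDr aa' idemP addr0.
have cI : (val a ** val b) ** (val a ** val b) = val a ** val b.
  by rewrite {1}abC rngmulA -(rngmulA _ (val a) (val a)) idemP -abC -rngmulA idemP.
have dI : (val a ** val b') ** (val a ** val b') = val a ** val b'.
  by rewrite {1}ab'C rngmulA -(rngmulA _ (val a) (val a)) idemP -ab'C -rngmulA idemP.
exists (mkidem cI), (mkidem dI); split => //.
- apply/esym/V_addE => //=.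
    by rewrite ab'C rngmulA -(rngmulA (val a) _ (val b')) bb' rngmulr0 rngmul0r.
  by rewrite abC rngmulA -(rngmulA (val a) _ (val b)) b'b rngmulr0 rngmul0r.
- apply: (@Vclass_le_factor _ _ (val a ** val b) (val b)) => /=.
  + by rewrite -rngmulA idemP.
  + by rewrite -rngmulA idemP.
  + by rewrite idemP.
- apply: (@Vclass_le_factor _ _ (val a ** val b') (val b')) => /=.
  + by rewrite -rngmulA idemP.
  + by rewrite -rngmulA idemP.
  + by rewrite idemP.
Qed.

End V_facts.

(** * The diagram of simplicial monoids *)

Section free_simplicial.

Lemma ffun_alg_le n (x y : {ffun 'I_n -> nat}) :
  alg_le x y <-> forall i, (x i <= y i)%N.
Proof.
split=> [[z ->] i|xy]; first by rewrite ffunE leq_addr.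
exists [ffun i => (y i - x i)%N]; apply/ffunP => i.
by rewrite !ffunE; apply/esym/subnKC.
Qed.

Lemma ffun_simplicial n : simplicial {ffun 'I_n -> nat}.
Proof. by exists n, idfun; split=> //; exists idfun. Qed.

Lemma ffun_order_unit n k :
  order_unit ([ffun=> k.+1] : {ffun 'I_n -> nat}).
Proof.
move=> x; exists (\max_(i < n) x i).+1 => //; apply/ffun_alg_le => i.
rewrite ffunMnE ffunE -mulr_natr natn.
apply: (@leq_trans (\max_(i < n) x i).+1); last exact: leq_pmull.
exact/leqW/(@leq_bigmax _ (fun i => x i)).
Qed.

(* (N^n, (k+1, ..., k+1)) *)
Definition Nn (n k : nat) : Semb1 :=
  SimplicialWithUnit (ffun_simplicial n) (@ffun_order_unit n k).

(** Surjectivity of [s] makes every coordinate of the argument reappear in the image, so the order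
    is reflected. *)
Fact pull_embedding n m k (s : 'I_m -> 'I_n) (ss : forall i, exists j, s j = i) :
  @normalized_embedding (Nn n k) (Nn m k)
    (fun x : {ffun 'I_n -> nat} => [ffun j => x (s j)] : {ffun 'I_m -> nat}).
Proof.
split; last by apply/ffunP => j; rewrite !ffunE.
split; first by split=> [|x y]; apply/ffunP => j; rewrite !ffunE.
move=> x y /ffun_alg_le xy; apply/ffun_alg_le => i.
by have [j <-] := ss i; have := xy j; rewrite !ffunE.
Qed.
Definition pull n m k s ss : hom (Nn n k) (Nn m k) :=
  exist _ _ (@pull_embedding n m k s ss).

(** Each coordinate reappears doubled at an index where [s] and [t] agree, so the order is
    reflected. The unit (1, ..., 1) goes to (2, ..., 2), whence the indices 0 and 1 of [Nn]. *)
Fact pull2_embedding n m (s t : 'I_m -> 'I_n)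
    (st : forall i, exists j, s j = i /\ t j = i) :
  @normalized_embedding (Nn n 0) (Nn m 1)
    (fun x : {ffun 'I_n -> nat} =>
       [ffun j => (x (s j) + x (t j))%N] : {ffun 'I_m -> nat}).
Proof.
split; last by apply/ffunP => j; rewrite !ffunE.
split.
  by split=> [|x y]; apply/ffunP => j; rewrite !ffunE // addnACA.
move=> x y /ffun_alg_le xy; apply/ffun_alg_le => i.
have [j [sj tj]] := st i; have := xy j.
by rewrite !ffunE sj tj !addnn leq_double.
Qed.
Definition pull2 n m s t st : hom (Nn n 0) (Nn m 1) :=
  exist _ _ (@pull2_embedding n m s t st).

End free_simplicial.

(** Coordinate j of N^4 is the entry (j / 2, j mod 2) of the 2 x 2 array. *)
Definition row_fst (j : 'I_4) : 'I_2 := inord (j %/ 2).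
Definition row_snd (j : 'I_4) : 'I_2 := inord (j %% 2).
(* The rows of a map N^4 -> N^5: twice each coordinate, then the sum of the
   coordinates i and 3 - i. *)
Definition row_sum (i : nat) (j : 'I_5) : 'I_4 := inord (if j == 4 :> nat then i else j).

Lemma const_surj (i : 'I_1) : exists j : 'I_2, ord0 = i.
Proof. by exists ord0; rewrite (ord1 i). Qed.

Lemma row_fst_eq j k : (row_fst j == k) = (j %/ 2 == k)%N.
Proof. by rewrite -val_eqE /= inordK // ltn_divLR. Qed.

Lemma row_snd_eq j k : (row_snd j == k) = (j %% 2 == k)%N.
Proof. by rewrite -val_eqE /= inordK // ltn_mod. Qed.

Lemma row_fst_surj (i : 'I_2) : exists j, row_fst j = i.
Proof.
have i4 : (i * 2 < 4)%N by case: i => [[|[|]]].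
by exists (inord (i * 2)); apply: val_inj; rewrite /row_fst /= !inordK ?mulnK.
Qed.

Lemma row_snd_surj (i : 'I_2) : exists j, row_snd j = i.
Proof.
have i4 : (i < 4)%N by apply: leq_trans (ltn_ord i) _.
exists (inord i); apply: val_inj.
by rewrite /row_snd /= (inordK i4) modn_small ?ltn_ord // inordK.
Qed.

Lemma row_sum_surj k k' (i : 'I_4) :
  exists j, row_sum k j = i /\ row_sum k' j = i.
Proof.
exists (widen_ord (leqnSn 4) i).
by rewrite /row_sum /= (ltn_eqF (ltn_ord i)); split; apply: val_inj; rewrite /= inordK.
Qed.

Definition emb0 : hom (Nn 1 0) (Nn 2 0) := pull 0 const_surj.
Definition embg (b : bool) : hom (Nn 2 0) (Nn 4 0) :=
  if b then pull 0 row_snd_surj else pull 0 row_fst_surj.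
Definition embf (b : bool) : hom (Nn 4 0) (Nn 5 1) :=
  if b then pull2 (row_sum_surj 1 2) else pull2 (row_sum_surj 0 3).

Lemma embg_emb0 : cmp (embg true) emb0 = cmp (embg false) emb0.
Proof. by apply: sval_inj; apply/funext => x; apply/ffunP => j; rewrite !ffunE. Qed.

(** In an array that is constant along rows or along columns, the two diagonals have the same sum;
    the doubled coordinates agree anyway. *)
Lemma embf_embg b : cmp (embf true) (embg b) = cmp (embf false) (embg b).
Proof.
apply: sval_inj; apply/funext => x; apply/ffunP => j.
by case: b; rewrite /= !ffunE; case: j => [[|[|[|[|[|]]]]] jP] //=;
  rewrite /row_sum /row_fst /row_snd /= !inordK // addnC.
Qed.

(** The antidiagonal sum is 0, while the diagonal sum is at least 1. *)
Lemma embf_neq (x : {ffun 'I_4 -> nat}) : x 0 = 1%N -> x 1 = 0%N -> x 2 = 0%N ->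
  sval (embf true) x <> sval (embf false) x.
Proof.
move=> x0 x1 x2 /ffunP/(_ ord_max); rewrite !ffunE /row_sum /=.
have inE k (kP : (k < 4)%N) : inord k = Ordinal kP by apply: val_inj; rewrite /= inordK.
have E k : (k < 4)%N -> inord k = (k%:R : 'I_4).
  by move=> k4; apply: val_inj; rewrite /= inordK // Zp_nat /= modn_small.
by rewrite !E // x0 x1 x2.
Qed.

(** * The contradiction drawn from a lifting of the diagram *)

Section no_functor.
Variable F : functor Semb1 Rngs.
Hypothesis F_rich : forall X, idem_rich (F X).
Variable h : forall X : Semb1, V_monoid (F X) -> swu_monoid X.
Hypothesis hM : forall X, nmod_morphism (h (X := X)).
Hypothesis h_bij : forall X, bijective (h (X := X)).
Hypothesis h_nat : forall (X Y : Semb1) (f : hom X Y) u,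
  sval f (h u) = h (V_map (svalP (fmap F f)) u).

(** Idempotents are transported, rather than classes: functoriality of [F] gives equalities between
    idempotents, which products require. *)
Let Fm (X Y : Semb1) (f : hom X Y) (a : idem (Minf (F X))) : idem (Minf (F Y)) :=
  idem_map (Minf_map_morph (svalP (fmap F f))) a.

Lemma h_Fm X Y (f : hom X Y) a : h (Vclass (Fm f a)) = sval f (h (Vclass a)).
Proof. by rewrite h_nat V_mapE. Qed.

Lemma Fm_cmp X Y Z (g : hom Y Z) (f : hom X Y) a :
  Fm (cmp g f) a = Fm g (Fm f a).
Proof.
apply: val_inj; apply: MinfP => i j /=.
by rewrite (fmapM F g f).
Qed.

Lemma h_le X (u v : V_monoid (F X)) : alg_le u v -> alg_le (h u) (h v).
Proof. by case=> w ->; exists (h w); rewrite (hM X).2. Qed.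

Lemma h_eq0 X (u : V_monoid (F X)) : h u = 0 -> u = 0.
Proof. by move=> u0; apply: (bij_inj (h_bij X)); rewrite u0 (hM X).1. Qed.

Lemma no_V_lifting : False.
Proof.
have [k hk kh] := h_bij (Nn 1 0).
have [k2 hk2 kh2] := h_bij (Nn 2 0).
pose e1 : idem (Minf (F (Nn 1 0))) := Vrepr (k (swu_unit (Nn 1 0))).
pose d (i : 'I_2) : Nn 2 0 := [ffun j => (j == i)%N : nat].
have [a [a' [ha ha' eE aa' a'a]]] : exists a a' : idem (Minf (F (Nn 2 0))),
    [/\ Vclass a = k2 (d 0), Vclass a' = k2 (d 1),
      val (Fm emb0 e1) = val a + val a', val a ** val a' = 0 & val a' ** val a = 0].
  apply: Vclass_split; apply: (bij_inj (h_bij (Nn 2 0))).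
  rewrite h_Fm (hM _).2 VreprK kh !kh2; apply/ffunP => i; rewrite !ffunE.
  by case: i => [[|[|]]].
pose A b := Fm (embg b) a; pose A' b := Fm (embg b) a'.
have AA' b : val (A b) ** val (A' b) = 0.
  rewrite -(Minf_map_morph (svalP (fmap F (embg b)))).2 aa'.
  exact: (Minf_map_morph _).1.1.
have A'A b : val (A' b) ** val (A b) = 0.
  rewrite -(Minf_map_morph (svalP (fmap F (embg b)))).2 a'a.
  exact: (Minf_map_morph _).1.1.
have AD b : val (A b) + val (A' b) = val (Fm (cmp (embg b) emb0) e1).
  rewrite Fm_cmp [RHS](congr1 (Minf_map (svalP (fmap F (embg b)))) eE).
  by rewrite (Minf_map_morph (svalP (fmap F (embg b)))).1.2.
have hA b : h (Vclass (A b)) = sval (embg b) (d 0) by rewrite h_Fm ha kh2.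
have hA' b : h (Vclass (A' b)) = sval (embg b) (d 1) by rewrite h_Fm ha' kh2.
(* The two rows of the array have disjoint supports. *)
have ort w : alg_le w (Vclass (A false)) -> alg_le w (Vclass (A' false)) -> w = 0.
  move=> /h_le; rewrite hA => /ffun_alg_le w0 /h_le; rewrite hA' => /ffun_alg_le w1.
  apply: h_eq0; apply/ffunP => i; have := w0 i; have := w1 i; rewrite !ffunE.
  by case: (row_fst i) => [[|[|]]] //= _; rewrite !leqn0 => /eqP; [move=> -> | move=> _ /eqP].
have [|c [c' [cE AE cB c'B']]] := Vclass_refine (b := A true) (b' := A' true)
  (@F_rich _) _ (AA' _) (A'A _) (AA' _) (A'A _) ort.
  by rewrite !AD embg_emb0.
pose x : {ffun 'I_4 -> nat} := h (Vclass c).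
pose x' : {ffun 'I_4 -> nat} := h (Vclass c').
(* The bounds by the first row and by the two columns determine the coordinates 0, 1 and 2 of
   [x]. *)
have xA i : (x i + x' i)%N = (row_fst i == 0).
  have := congr1 (fun y : {ffun 'I_4 -> nat} => y i) (hA false).
  by rewrite AE (hM _).2 !ffunE.
have xB i : (x i <= (row_snd i == 0%R))%N.
  by move/h_le: cB; rewrite hA => /ffun_alg_le/(_ i); rewrite !ffunE.
have xB' i : (x' i <= (row_snd i == 1%R))%N.
  by move/h_le: c'B'; rewrite hA' => /ffun_alg_le/(_ i); rewrite !ffunE.
case: (@embf_neq x).
- by have := xA 0; have := xB' 0; rewrite row_fst_eq row_snd_eq leqn0 => /eqP ->; rewrite addn0.
- by have := xB 1; rewrite row_snd_eq leqn0 => /eqP.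
- by have := xA 2; rewrite row_fst_eq => /eqP; rewrite addn_eq0 => /andP[/eqP].
(* As an element, [c] is the product of [A false] and [A true], and each factor has the same image
   under both maps [embf]. *)
rewrite /x -!h_Fm; congr (h (Vclass _)); apply: val_inj => /=.
rewrite cE !(Minf_map_morph _).2.
rewrite -![Minf_map _ _]/(val (Fm _ (A _))).
by rewrite -!Fm_cmp !embf_embg.
Qed.
End no_functor.

Lemma no_rich_lifting (F : functor Semb1 Rngs) : (forall X, idem_rich (F X)) ->
  ~ nat_isomorphic (functor_comp V F) forget_unit.
Proof.
move=> rich [eta [eta_iso eta_nat]].
apply: (@no_V_lifting F rich (fun X => sval (eta X))) => [X|X|X Y f u].
- exact: (svalP (eta X)).
- have [g [/(congr1 sval)/= gK /(congr1 sval)/= Kg]] := eta_iso X.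
  by exists (sval g) => u; [move/(congr1 (@^~ u)): gK|move/(congr1 (@^~ u)): Kg].
- exact: (congr1 (fun g => sval g u) (eta_nat X Y f)).
Qed.

(** * Power series in a C*-algebra *)

Section real_norm.
Variables (R : realType) (A : cstarAlgType R).
Implicit Types x y : A.

(** Norms have values in [R[i]]; real values allow the use of [lra] and [nra]. *)
Definition rnorm x : R := complex.Re `|x|.

Lemma rnormE x : `|x| = (rnorm x)%:C.
Proof. by rewrite /rnorm RRe_real // ger0_real. Qed.

Lemma rnorm_ge0 x : 0 <= rnorm x.
Proof. by rewrite -ler0c -rnormE. Qed.

Lemma rnorm0 : rnorm 0 = 0.
Proof. by apply: complexI; rewrite -rnormE normr0. Qed.

Lemma rnorm_eq0 x : rnorm x = 0 -> x = 0.
Proof. by move=> x0; apply/eqP; rewrite -normr_eq0 rnormE x0. Qed.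

Lemma rnormD x y : rnorm (x + y) <= rnorm x + rnorm y.
Proof. by rewrite -lecR rmorphD /= -!rnormE ler_normD. Qed.

Lemma rnormN x : rnorm (- x) = rnorm x.
Proof. by rewrite /rnorm normrN. Qed.

Lemma rnormB x y : rnorm (x - y) <= rnorm x + rnorm y.
Proof. by rewrite -(rnormN y) rnormD. Qed.

Lemma rnorm_rngmul x y : rnorm (x ** y) <= rnorm x * rnorm y.
Proof. by rewrite -lecR rmorphM /= -!rnormE rngmul_norm. Qed.

Lemma rnormZ (k : R) x : rnorm (k%:C *: x) = `|k| * rnorm x.
Proof.
apply: complexI; rewrite -rnormE normrZ rmorphM /= -!rnormE; congr (_ * _).
by rewrite normc_def /= expr0n /= addr0 sqrtr_sqr.
Qed.

Lemma rnorm_cstar x : rnorm (star x ** x) = rnorm x ^+ 2.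
Proof. by apply: complexI; rewrite -rnormE cstar_norm rnormE rmorphXn. Qed.

(** The C*-identity and submultiplicativity give |y|^2 <= |star y| |y|; cancel |y| and apply the
    result to [star y] as well. *)
Lemma rnorm_star x : rnorm (star x) = rnorm x.
Proof.
have le y : rnorm y <= rnorm (star y).
  have [->|y0] := eqVneq (rnorm y) 0; first exact: rnorm_ge0.
  have yp : 0 < rnorm y by rewrite lt_def y0 rnorm_ge0.
  by rewrite -(ler_pM2r yp) -expr2 -rnorm_cstar rnorm_rngmul.
by apply/eqP; rewrite eq_le le -{2}(starK x) le.
Qed.

Definition rnorm_cvg (u : nat -> A) (l : A) : Prop :=
  forall e : R, 0 < e -> exists N, forall n, (N <= n)%N -> rnorm (u n - l) < e.

Lemma rnorm_complete (u : nat -> A) :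
  (forall e : R, 0 < e -> exists N, forall n, (N <= n)%N -> rnorm (u n - u N) < e) ->
  exists l, rnorm_cvg u l.
Proof.
move=> uC.
have complexR (e : R[i]) : 0 < e -> exists2 r : R, 0 < r & e = r%:C.
  by move=> e0; have /complex_realP[r E] := gtr0_real e0; exists r => //;
    rewrite -ltcR -E.
have cau : cauchy (u @ \oo)%classic.
  apply/cauchy_exP => e /complexR[r r0 ->]; have [N uN] := uC r r0.
  exists (u N), N => // n /= /uN; rewrite -ball_normE /= distrC rnormE.
  by rewrite ltcR.
have /cauchy_cvg /cvg_ex[l /cvgrPdist_lt ul] := cau.
exists l => e e0; have [|N _ uN] := ul e%:C; first by rewrite ltcR.
by exists N => n /uN /=; rewrite distrC rnormE ltcR.
Qed.

Lemma rnorm_cvg_unique (u : nat -> A) l l' : rnorm_cvg u l -> rnorm_cvg u l' -> l = l'.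
Proof.
move=> ul ul'; apply/eqP; rewrite -subr_eq0; apply/eqP/rnorm_eq0/eqP.
rewrite eq_le rnorm_ge0 andbT; apply/ler_addgt0Pl => e e0; rewrite addr0.
have [N uN] := ul _ (divr_gt0 e0 (ltr0n _ 2)).
have [N' uN'] := ul' _ (divr_gt0 e0 (ltr0n _ 2)).
have := uN _ (leq_maxl N N'); have := uN' _ (leq_maxr N N').
have := rnormB (u (maxn N N') - l') (u (maxn N N') - l).
have -> : u (maxn N N') - l' - (u (maxn N N') - l) = l - l'.
  by rewrite opprB addrC addrA subrK.
by lra.
Qed.

Lemma rnorm_cvg_lipschitz (f : A -> A) (C : R) u l :
  (forall x y, rnorm (f x - f y) <= C * rnorm (x - y)) ->
  rnorm_cvg u l -> rnorm_cvg (f \o u) (f l).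
Proof.
move=> fC ul e e0.
have C0 : 0 < `|C| + 1 by rewrite ltr_wpDl.
have [N uN] := ul _ (divr_gt0 e0 C0).
exists N => n /uN un; apply: le_lt_trans (fC _ _) _.
apply: (@le_lt_trans _ _ ((`|C| + 1) * rnorm (u n - l))).
  rewrite ler_wpM2r ?rnorm_ge0 //; by rewrite (le_trans (ler_norm C)) // lerDl.
by rewrite mulrC -ltr_pdivlMr.
Qed.

Lemma rnorm_cvg_rnorm_le (u : nat -> A) l (r : R) :
  (forall n, rnorm (u n) <= r) -> rnorm_cvg u l -> rnorm l <= r.
Proof.
move=> ur ul; apply/ler_addgt0Pr => e e0; have [N uN] := ul e e0.
have := uN _ (leqnn N); have := ur N; have := rnormB (u N) (u N - l).
by rewrite opprB addrC subrK; lra.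
Qed.

(** Banach's fixed point theorem on a closed invariant set [P]. Norm bounds, self-adjointness and
    membership in a bicommutant are put into [P] and so pass to the fixed point. *)
Lemma contraction_fixed (P : A -> Prop) (F : A -> A) (q : R) x0 :
  0 <= q < 1 -> P x0 -> (forall x, P x -> P (F x)) ->
  (forall x y, P x -> P y -> rnorm (F x - F y) <= q * rnorm (x - y)) ->
  (forall u l, (forall n, P (u n)) -> rnorm_cvg u l -> P l) ->
  exists2 x, P x & F x = x.
Proof.
move=> /andP[q0 q1] P0 PF Fq Pcl.
pose u n := iter n F x0.
have Pu n : P (u n) by elim: n => //= n; exact: PF.
pose D := rnorm (u 1%N - u 0%N).
have D0 : 0 <= D by exact: rnorm_ge0.
have q1' : 0 < 1 - q by rewrite subr_gt0.
have step n : rnorm (u n.+1 - u n) <= q ^+ n * D.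
  elim: n => [|n IH]; first by rewrite expr0 mul1r.
  by apply: le_trans (Fq _ _ (Pu n.+1) (Pu n)) _; rewrite exprS -mulrA ler_wpM2l.
have dist n m : rnorm (u (n + m)%N - u n) <= q ^+ n * D / (1 - q).
  (* The exact value of the finite geometric sum is what the induction on [m] can carry. *)
  suff: rnorm (u (n + m)%N - u n) <= q ^+ n * D / (1 - q) * (1 - q ^+ m).
    move=> /le_trans -> //; rewrite ler_piMr ?divr_ge0 ?mulr_ge0 ?exprn_ge0 ?(ltW q1') //.
    by rewrite lerBlDr lerDl exprn_ge0.
  elim: m => [|m IH]; first by rewrite addn0 subrr rnorm0 expr0 subrr mulr0.
  rewrite addnS -(subrK (u (n + m)%N) (u _.+1)) -addrA.
  apply: le_trans (rnormD _ _) _; apply: le_trans (lerD (step _) IH) _.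
  rewrite le_eqVlt; apply/orP; left; apply/eqP.
  by rewrite exprD exprS; field; rewrite gt_eqF.
have [l ul] : exists l, rnorm_cvg u l.
  apply: rnorm_complete => e e0.
  (* Adding 1 to [D] avoids a division by 0. *)
  have /cvgrPdist_lt/(_ (e * (1 - q) / (D + 1))) : ((fun n => q ^+ n) @ \oo --> (0 : R))%classic.
    by apply: cvg_expr; rewrite ger0_norm.
  case; first by rewrite divr_gt0 ?mulr_gt0 // ltr_wpDl.
  move=> N _ /(_ N (leqnn N)) /=; rewrite sub0r normrN ger0_norm ?exprn_ge0 // => qN.
  exists N => n /subnKC <-; apply: le_lt_trans (dist _ _) _.
  rewrite ltr_pdivrMr //; move: qN; rewrite ltr_pdivlMr ?ltr_wpDl // => qN.
  apply: le_lt_trans qN; rewrite ler_wpM2l ?exprn_ge0 //; lra.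
exists l; first exact: Pcl ul.
have ul' : rnorm_cvg (fun n => u n.+1) l.
  by move=> e /ul[N uN]; exists N => n Nn; apply: uN; exact: leqW.
apply: (rnorm_cvg_unique (u := fun n => u n.+1)) => // e e0.
have [N uN] := ul e e0; exists N => n /uN; apply: le_lt_trans.
apply: le_trans (Fq _ _ (Pu n) (Pcl _ _ Pu ul)) _.
by rewrite ler_piMl ?rnorm_ge0 ?ltW.
Qed.

End real_norm.

(** * Bicommutants and their closure under limits *)

Section bicommutant.
Variables (R : realType) (A : cstarAlgType R).
Implicit Types (x y z k q : A).

Lemma star0 : star (0 : A) = 0.
Proof. by apply: (addrI (star 0)); rewrite -starD !addr0. Qed.

Lemma starN x : star (- x) = - star x.
Proof. by apply: (addrI (star x)); rewrite -starD !subrr star0. Qed.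

Lemma starB x y : star (x - y) = star x - star y.
Proof. by rewrite starD starN. Qed.

Lemma starZr (r : R) x : star (r%:C *: x) = r%:C *: star x.
Proof. by rewrite starZ conjc_real. Qed.

(** The bicommutant of [k] stands in for the closed subalgebra generated by [k]: it is commutative
    and contains the limits of the iterations below. *)
Definition bicom k x : Prop := forall c, c ** k = k ** c -> c ** x = x ** c.

Lemma bicom_refl k : bicom k k. Proof. by []. Qed.

Lemma bicom_trans k x y : bicom k x -> bicom x y -> bicom k y.
Proof. by move=> kx xy c /kx/xy. Qed.

Lemma bicomC k x y : bicom k x -> bicom k y -> x ** y = y ** x.
Proof. by move=> kx ky; apply/ky/esym/kx. Qed.

Lemma bicom0 k : bicom k 0.
Proof. by move=> c _; rewrite rngmul0r rngmulr0. Qed.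

Lemma bicomD k x y : bicom k x -> bicom k y -> bicom k (x + y).
Proof. by move=> kx ky c ck; rewrite rngmulDl rngmulDr kx // ky. Qed.

Lemma bicomN k x : bicom k x -> bicom k (- x).
Proof. by move=> kx c ck; rewrite rngmulNr rngmulrN kx. Qed.

Lemma bicomB k x y : bicom k x -> bicom k y -> bicom k (x - y).
Proof. by move=> kx ky; apply: bicomD => //; exact: bicomN. Qed.

Lemma bicomZ k (a : R[i]) x : bicom k x -> bicom k (a *: x).
Proof. by move=> kx c ck; rewrite rngmulZl rngmulZr kx. Qed.

Lemma bicomM k x y : bicom k x -> bicom k y -> bicom k (x ** y).
Proof. by move=> kx ky c ck; rewrite rngmulA kx // -rngmulA ky // rngmulA. Qed.

Lemma rngmul_lipl c x y : rnorm (c ** x - c ** y) <= rnorm c * rnorm (x - y).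
Proof. by rewrite -rngmulBr rnorm_rngmul. Qed.

Lemma rngmul_lipr c x y : rnorm (x ** c - y ** c) <= rnorm c * rnorm (x - y).
Proof. by rewrite -rngmulBl mulrC rnorm_rngmul. Qed.

Lemma bicom_lim k u l : (forall n, bicom k (u n)) -> rnorm_cvg u l -> bicom k l.
Proof.
move=> ku ul c ck.
have := rnorm_cvg_lipschitz (rngmul_lipr c) ul.
have := rnorm_cvg_lipschitz (rngmul_lipl c) ul.
have -> : (rngmul c) \o u = (rngmul^~ c) \o u by apply/funext => n /=; exact: ku.
exact: rnorm_cvg_unique.
Qed.

End bicommutant.

(** * Square roots, Neumann series and quasi-inverses *)

Section power_series.
Variables (R : realType) (A : cstarAlgType R).
Implicit Types (x y z k q : A).

Definition sa x : Prop := star x = x.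

Lemma sa_lim (u : nat -> A) l : (forall n, sa (u n)) -> rnorm_cvg u l -> sa l.
Proof.
move=> us ul; apply: rnorm_cvg_unique (ul).
have <- : star \o u = u by apply/funext => n /=; exact: us.
apply: (rnorm_cvg_lipschitz (C := 1)) ul => x y.
by rewrite mul1r -starB rnorm_star.
Qed.

(* The solution z of z = (y + z^2)/2 satisfies (1 - z)^2 = 1 - y. *)
Lemma sqrt_exists y : rnorm y < 1 -> exists z,
  [/\ z + z = y + z ** z, rnorm z <= rnorm y, bicom y z & sa y -> sa z].
Proof.
move=> y1; have y0 := rnorm_ge0 y.
pose F z : A := (2^-1 : R)%:C *: (y + z ** z).
pose P z := [/\ rnorm z <= rnorm y, bicom y z & sa y -> sa z].
have [| | | | |z [? ? ?] Fz] := @contraction_fixed R A P F (rnorm y) 0.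
- by rewrite y0.
- by split=> [||_]; [rewrite rnorm0|exact: bicom0|exact: star0].
- move=> z [zy yz sz]; split.
  + rewrite rnormZ ger0_norm ?invr_ge0 //.
    have := rnormD y (z ** z); have := rnorm_rngmul z z.
    have := rnorm_ge0 z; nra.
  + by apply/bicomZ/bicomD => //; exact: bicomM.
  + by move=> ys; rewrite /sa /F starZr starD starM ys sz.
- move=> x z [xy yx _] [zy yz _]; rewrite /F -scalerBr rnormZ ger0_norm ?invr_ge0 //.
  (* On the ball of radius norm y this factorization gives the contraction constant norm y. *)
  have -> : y + x ** x - (y + z ** z) = x ** (x - z) + (x - z) ** z.
    by rewrite rngmulBr rngmulBl addrA subrK opprD addrACA subrr add0r.
  have := rnormD (x ** (x - z)) ((x - z) ** z).
  have := rnorm_rngmul x (x - z); have := rnorm_rngmul (x - z) z.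
  have := rnorm_ge0 (x - z); nra.
- move=> u l Pu ul; split.
  + by apply: rnorm_cvg_rnorm_le ul => n; case: (Pu n).
  + by apply: bicom_lim ul => n; case: (Pu n).
  + by move=> ys; apply: sa_lim ul => n; case: (Pu n) => _ _; apply.
exists z; split => //; transitivity ((2 : R)%:C *: F z).
  by rewrite Fz rmorph_nat scaler_nat mulr2n.
by rewrite scalerA -rmorphM /= divff ?scale1r // pnatr_eq0.
Qed.

(* 1 + n is the inverse of 1 - y. *)
Lemma neumann y : rnorm y < 1 -> exists n,
  [/\ n = y + y ** n, rnorm n <= rnorm y / (1 - rnorm y) & bicom y n].
Proof.
move=> y1; have y0 := rnorm_ge0 y.
have y1' : 0 < 1 - rnorm y by rewrite subr_gt0.
pose F n : A := y + y ** n.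
pose P n := rnorm n <= rnorm y / (1 - rnorm y) /\ bicom y n.
have [| | | | |z [? ?] Fz] := @contraction_fixed R A P F (rnorm y) 0.
- by rewrite y0.
- by split; [rewrite rnorm0 divr_ge0 // ltW|exact: bicom0].
- move=> z [zy yz]; split; last by apply/bicomD => //; exact: bicomM.
  apply: le_trans (rnormD _ _) _.
  apply: (@le_trans _ _ (rnorm y + rnorm y * (rnorm y / (1 - rnorm y)))).
    by rewrite lerD2l; apply: le_trans (rnorm_rngmul _ _) _; rewrite ler_wpM2l.
  by rewrite le_eqVlt; apply/orP; left; apply/eqP; field; rewrite gt_eqF.
- move=> x z _ _; rewrite /F opprD addrACA subrr add0r -rngmulBr.
  exact: rnorm_rngmul.
- move=> u l Pu ul; split.
  + by apply: rnorm_cvg_rnorm_le ul => n; case: (Pu n).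
  + by apply: bicom_lim ul => n; case: (Pu n).
by exists z; split => //; rewrite -[LHS]Fz.
Qed.

(* 1 - q is the inverse of 1 - k in the unitization. *)
Definition qinv k q : Prop := k + q = k ** q /\ k + q = q ** k.

(** In the unitization, 1 - [circ x y] = (1 - x)(1 - y); hence associativity and the identity 0. *)
Definition circ x y : A := x + y - x ** y.

Lemma circA : associative circ.
Proof.
move=> x y z; rewrite /circ !rngmulBr !rngmulBl !rngmulDr !rngmulDl !rngmulA.
by rewrite !opprB !opprD !addrA [LHS](ACl (1*2*6*3*5*7*4)).
Qed.

Lemma circ0 : right_id 0 circ.
Proof. by move=> x; rewrite /circ addr0 rngmulr0 subr0. Qed.

Lemma circ0l : left_id 0 circ.
Proof. by move=> x; rewrite /circ add0r rngmul0r subr0. Qed.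

Lemma circ_eq0 x y : (circ x y = 0) <-> (x + y = x ** y).
Proof. by rewrite /circ; split=> [/subr0_eq|->]; rewrite ?subrr. Qed.

Lemma qinvP k q : qinv k q <-> circ k q = 0 /\ circ q k = 0.
Proof.
split=> -[a b]; split; [exact/circ_eq0|by apply/circ_eq0; rewrite addrC|
  exact/circ_eq0|by move/circ_eq0: b; rewrite addrC].
Qed.

(** If c commutes with k, the commutator D = c q - q c satisfies (1 - k) D = 0, and 1 - k is
    invertible. *)
Lemma qinv_bicom k q : qinv k q -> bicom k q.
Proof.
move=> [kq qk] c ck.
pose D := c ** q - q ** c.
have kD : D = k ** D.
  rewrite rngmulBr !rngmulA -ck -kq -(rngmulA c) -kq rngmulDr rngmulDl ck.
  by rewrite opprD addrACA subrr add0r.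
have : (k + q) ** D = q ** D by rewrite qk -rngmulA -kD.
move=> kqD; apply/subr0_eq/(addIr (q ** D)).
by rewrite -/D {1}kD -rngmulDl kqD add0r.
Qed.

(** The adjoint of a right inverse of 1 - k is a left inverse of it, so the two coincide. *)
Lemma sa_qinv k r : sa k -> circ k r = 0 -> qinv k r /\ sa r.
Proof.
move=> sk kr.
have rk : circ (star r) k = 0.
  by have := congr1 star kr; rewrite /circ starB starD starM sk star0 (addrC k).
have E : star r = r by rewrite -[LHS]circ0 -kr circA rk circ0l.
by split=> //; apply/qinvP; rewrite -{2}E.
Qed.

(** The product (1 - q)(1 - k') is 1 - (1 - q)(k' - k), which a Neumann series inverts. *)
Lemma qinv_open k q k' : qinv k q -> sa k' -> rnorm (k' - k) * (1 + rnorm q) < 1 ->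
  exists q', qinv k' q' /\ sa q'.
Proof.
move=> /qinvP[kq qk] sk' lt1.
have [n [nE _ yn]] : exists n, [/\ n = circ q k' + circ q k' ** n, True & bicom (circ q k') n].
  have [|n [? _ ?]] := @neumann (circ q k'); last by exists n.
  have -> : circ q k' = (k' - k) - q ** (k' - k).
    move: qk => /circ_eq0 qk; rewrite rngmulBr -qk /circ.
    by rewrite opprB !addrA [_ + k]addrAC subrK (addrC q).
  apply: le_lt_trans lt1; rewrite mulrDr mulr1.
  by apply: le_trans (rnormB _ _) _; rewrite lerD2l mulrC rnorm_rngmul.
(* With y = [circ q k'], 1 - k' = (1 - k)(1 - y) has the right inverse (1 + n)(1 - q); [sa_qinv]
   makes it two-sided. *)
exists (circ (- n) q); apply: sa_qinv => //.
have yn0 : circ (circ q k') (- n) = 0.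
  by apply/circ_eq0; rewrite rngmulrN {1}nE opprD addrA subrr add0r.
have -> : k' = circ k (circ q k') by rewrite circA kq circ0l.
by rewrite circA -(circA k) yn0 circ0.
Qed.

End power_series.

(** * Real rank 0 *)

Section density.
Variables (R : realType) (A : cstarAlgType R).
Implicit Types (x y z k q h : A).

Lemma closure_rnorm (S : set A) x (e : R) : closure S x -> 0 < e ->
  exists2 y, S y & rnorm (y - x) < e.
Proof.
move=> clS e0; have e0' : 0 < e%:C by rewrite ltcR.
have [y [Sy]] := clS _ (nbhsx_ballx x _ e0').
by rewrite -ball_normE /= distrC rnormE ltcR => yx; exists y.
Qed.

Lemma closure_rnorm_pair (S : set (A * (R[i])^o)%type) (x : (A * (R[i])^o)%type) (e : R) : closure S x -> 0 < e ->
  exists2 y, S y & rnorm (y.1 - x.1) < e /\ `|y.2 - x.2| < e%:C.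
Proof.
move=> clS e0; have e0' : 0 < e%:C by rewrite ltcR.
have [y [Sy [yx1 yx2]]] := clS _ (nbhsx_ballx x _ e0').
exists y => //; split; last by rewrite distrC; exact: yx2.
by move: yx1; rewrite -ball_normE /= distrC rnormE ltcR.
Qed.

(** Density is applied at h - 1, in [A] or in its unitization. In the second case the scalar part
    [a] of the approximant is real and close to -1, and multiplying by -1/a turns it into -1. *)
Lemma rr0_qinv_dense h (e : R) : real_rank0 A -> sa h -> 0 < e ->
  exists k q, [/\ sa k, qinv k q & rnorm (k - h) < e].
Proof.
move=> [rrU rrN] sh e0; have [[u uU]|nU] := pselect (exists u : A, rng_unit u).
  have su : star u = u.
    have E : star u ** u = star u by exact: (uU _).2.
    by have := congr1 star E; rewrite starM starK E.
  have shu : star (h - u) = h - u by rewrite starB sh su.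
  have [y [sy [w [yw wy]]] yh] := closure_rnorm (rrU _ uU _ shu) e0.
  exists (u + y), (u + w); split; first by rewrite /sa starD su sy.
    by rewrite /qinv !rngmulDl !rngmulDr !(uU _).1 !(uU _).2 yw wy !addrA;
      split; [rewrite [LHS](ACl (1*4*2*3))|rewrite [LHS](ACl (1*2*4*3))].
  by rewrite (_ : u + y - h = y - (h - u)) // opprB addrA (addrC u).
pose s1 := 1 + rnorm h; have s1p : 0 < s1 by rewrite ltr_pwDl ?rnorm_ge0.
(* The bound 1/2 ensures -1/a < 2. The other bound, D = e / (4 s1), leaves an error of at most 2 D +
   2 D |h| = 2 D s1 < e. *)
pose d := Num.min (2^-1) (e / (4 * s1)).
have d0 : 0 < d by rewrite lt_min invr_gt0 ltr0n divr_gt0 ?mulr_gt0.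
have sh1 : unitization_star (h, -1) = (h, -1).
  by congr (_, _); [exact: sh|exact: (etrans (rmorphN _ _) (congr1 _ (rmorph1 _)))].
have [[y m] [[sy sm] [[w n] [yw wy]]] /= [yh mh]] := closure_rnorm_pair (rrN nU _ sh1) d0.
pose a := complex.Re m.
have mE : m = a%:C.
  by rewrite /a RRe_real //; apply/CrealP.
case: yw wy => yw mn [wy _]; rewrite mE in yw wy mn mh.
have a0 : a != 0 by apply/eqP => a0; move: mn; rewrite a0 mul0r => /esym/eqP; rewrite oner_eq0.
have nE : n = a^-1%:C.
  by apply: (mulfI (x := a%:C)); rewrite ?fmorph_eq0 // mn -rmorphM /= divff.
have ad : `|a + 1| < d.
  move: mh; rewrite opprK -(rmorph1 (real_complex R)) -rmorphD /= normc_def /=.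
  by rewrite expr0n /= addr0 sqrtr_sqr ltcR.
rewrite nE in yw wy.
exists ((- a^-1)%:C *: y), ((- a)%:C *: w); split.
- by rewrite /sa starZr sy.
- have kq : (- a^-1)%:C *: y + (- a)%:C *: w = y ** w.
    rewrite !rmorphN !scaleNr -opprD addrC; apply/eqP; rewrite eq_sym -addr_eq0.
    by rewrite addrA; apply/eqP.
  have cc : (- a^-1)%:C * (- a)%:C = 1 :> R[i] by rewrite -rmorphM mulrNN mulVf.
  split; rewrite rngmulZl rngmulZr scalerA; first by rewrite cc scale1r.
  rewrite mulrC cc scale1r kq; apply: (addIr (a%:C *: w + a^-1%:C *: y)).
  by rewrite !addrA yw addrAC wy.
move: d0 ad; rewrite /d lt_min => /andP[_ _]; rewrite lt_min => /andP[ad1 ad2].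
move: yh; rewrite lt_min => /andP[_ yh].
have -> : (- a^-1)%:C *: y - h = (- a^-1)%:C *: (y - h) + (- a^-1 - 1)%:C *: h.
  by rewrite scalerBr rmorphB /= rmorph1 scalerBl scale1r addrA subrK.
apply: le_lt_trans (rnormD _ _) _; rewrite !rnormZ.
have a_lt : a < - 2^-1 by move: ad1; rewrite ltr_norml => /andP[_]; lra.
have s0 : 0 < - a^-1 by rewrite oppr_gt0 invr_lt0; lra.
have s2 : - a^-1 < 2 by rewrite -invrN invf_plt ?posrE; lra.
have sE : - a^-1 - 1 = (- a^-1) * (a + 1) by rewrite mulrDr mulNr mulVf // mulr1 addrC.
rewrite sE normrM (gtr0_norm s0).
have h0 := rnorm_ge0 h; have yh0 := rnorm_ge0 (y - h); have a10 := normr_ge0 (a + 1).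
set D := e / _ in ad2 yh.
have eE : e = 4 * s1 * D by rewrite mulrC divfK // gt_eqF // mulr_gt0.
have t1 : (- a^-1) * rnorm (y - h) <= 2 * D by apply: ler_pM => //; exact: ltW.
have t2 : (- a^-1) * `|a + 1| <= 2 * D by apply: ler_pM => //; exact: ltW.
have D0 : 0 < D by lra.
have := ler_wpM2r h0 t2; have := mulr_ge0 (ltW D0) h0.
by rewrite eE /s1; lra.
Qed.

(** First approximate h by k1 with 1 - k1 invertible, then -k1 by k2 with 1 - k2 invertible, so
    closely that 1 + k2 stays invertible; take k = -k2. *)
Lemma rr0_qinv_dense2 h (e : R) : real_rank0 A -> sa h -> 0 < e ->
  exists k q q', [/\ sa k, qinv k q, qinv (- k) q' & rnorm (k - h) < e].
Proof.
move=> rr sh e0; have e2 : 0 < e / 2 by rewrite divr_gt0.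
have [k1 [q1 [sk1 kq1 k1h]]] := rr0_qinv_dense rr sh e2.
have Q1 : 0 < 1 + rnorm q1 by rewrite ltr_pwDl ?rnorm_ge0.
have d0 : 0 < Num.min (e / 2) (1 + rnorm q1)^-1 by rewrite lt_min e2 invr_gt0.
have sk1' : sa (- k1) by rewrite /sa starN sk1.
have [k2 [q2 [sk2 kq2]]] := rr0_qinv_dense rr sk1' d0.
rewrite lt_min => /andP[k21 k21'].
have E : rnorm (- k2 - k1) = rnorm (k2 - - k1) by rewrite -opprD rnormN opprK.
have sk2' : sa (- k2) by rewrite /sa starN sk2.
have [|q [kq _]] := @qinv_open _ _ k1 q1 (- k2) kq1 sk2'.
  by rewrite E -ltr_pdivlMr // div1r.
exists (- k2), q, q2; split=> //; first by rewrite opprK.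
rewrite -(subrK k1 (- k2)) -addrA; apply: le_lt_trans (rnormD _ _) _.
by rewrite E; lra.
Qed.

(* With a = h + i w, 2 h = a + a^* and a^* a = h^2 + w^2. *)
Lemma sa_rnorm_sqr h w : sa h -> sa w -> h ** w = w ** h ->
  rnorm h ^+ 2 <= rnorm (h ** h + w ** w).
Proof.
move=> sh sw hw; pose a := h + 'i *: w.
have ci : 'i^* = - 'i :> R[i] by apply/eqP; rewrite eq_complex /= oppr0 !eqxx.
have ii : 'i * 'i = -1 :> R[i] by rewrite -expr2 sqr_i.
have sa' : star a = h - 'i *: w by rewrite starD starZ sh sw ci scaleNr.
have aa : star a ** a = h ** h + w ** w.
  rewrite sa' /a rngmulBl !rngmulDr !rngmulZl !rngmulZr hw scalerA.
  by rewrite ii opprD addrA addrK scaleN1r opprK.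
rewrite -aa rnorm_cstar lerXn2r ?nnegrE ?rnorm_ge0 //.
have h2 : a + star a = (2 : R)%:C *: h.
  by rewrite sa' /a addrACA subrr addr0 rmorph_nat scaler_nat mulr2n.
have := rnormD a (star a); rewrite h2 rnormZ rnorm_star ger0_norm //; lra.
Qed.

Lemma rnorm_sa_sqr h : sa h -> rnorm (h ** h) = rnorm h ^+ 2.
Proof. by move=> sh; rewrite -rnorm_cstar sh. Qed.

End density.

(** * A commutative ring for computing in the bicommutant *)

Section bicommutant_ring.
Variables (R : realType) (A : cstarAlgType R) (k : A).

(* The unitization of the bicommutant of k is a commutative ring, in which the
   [ring] tactic proves the identities between k and the limits of power series
   in k. *)
Record bcom := Bcom { bvec : A; bsc : R[i]; bvecP : bicom k bvec }.
Implicit Types u v w : bcom.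

Lemma bcomP u v : bvec u = bvec v -> bsc u = bsc v -> u = v.
Proof.
by case: u v => x a xP [y b yP] /= xy ab; subst y b; congr Bcom; exact: Prop_irrelevance.
Qed.

Definition bcom0 := Bcom 0 (@bicom0 _ _ k).
Definition bcom1 := Bcom 1 (@bicom0 _ _ k).
Definition bcom_opp u := Bcom (- bsc u) (bicomN (bvecP u)).
Definition bcom_add u v := Bcom (bsc u + bsc v) (bicomD (bvecP u) (bvecP v)).
Definition bcom_mul u v := Bcom (bsc u * bsc v)
  (bicomD (bicomD (bicomM (bvecP u) (bvecP v)) (bicomZ (bsc u) (bvecP v)))
          (bicomZ (bsc v) (bvecP u))).

HB.instance Definition _ := gen_eqMixin bcom.
HB.instance Definition _ := gen_choiceMixin bcom.

Fact bcom_addA : associative bcom_add.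
Proof. by move=> u v w; apply: bcomP; rewrite /= addrA. Qed.
Fact bcom_addC : commutative bcom_add.
Proof. by move=> u v; apply: bcomP; rewrite /= addrC. Qed.
Fact bcom_add0 : left_id bcom0 bcom_add.
Proof. by move=> u; apply: bcomP; rewrite /= add0r. Qed.
Fact bcom_addN : left_inverse bcom0 bcom_opp bcom_add.
Proof. by move=> u; apply: bcomP; rewrite /= addNr. Qed.

HB.instance Definition _ :=
  GRing.isZmodule.Build bcom bcom_addA bcom_addC bcom_add0 bcom_addN.

Fact bcom_mulA : associative bcom_mul.
Proof.
move=> u v w; apply: bcomP; rewrite /= ?mulrA //.
rewrite !rngmulDl !rngmulDr !scalerDr !rngmulZl !rngmulZr !rngmulA !scalerA.
rewrite !addrA (mulrC (bsc w)) (mulrC (bsc w)).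
by rewrite [LHS](ACl (1*4*2*5*3*6*7)) /=.
Qed.
Fact bcom_mulC : commutative bcom_mul.
Proof.
move=> u v; apply: bcomP; rewrite /= 1?mulrC //.
by rewrite (bicomC (bvecP u) (bvecP v)) addrAC.
Qed.
Fact bcom_mul1 : left_id bcom1 bcom_mul.
Proof.
by move=> u; apply: bcomP; rewrite /= ?mul1r // rngmul0r scale1r scaler0 addr0 add0r.
Qed.
Fact bcom_mulDl : left_distributive bcom_mul +%R.
Proof.
move=> u v w; apply: bcomP; rewrite /= ?mulrDl // rngmulDl scalerDl scalerDr.
by rewrite !addrA [LHS](ACl (1*3*5*2*4*6)).
Qed.
Fact bcom_1neq0 : bcom1 != 0.
Proof. by apply/eqP => /(congr1 bsc)/eqP; rewrite oner_eq0. Qed.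

HB.instance Definition _ := GRing.Zmodule_isComNzRing.Build bcom
  bcom_mulA bcom_mulC bcom_mul1 bcom_mulDl bcom_1neq0.

Definition bv x (xP : bicom k x) := Bcom 0 xP.
Definition bs (a : R) := Bcom a%:C (@bicom0 _ _ k).

Lemma bv_inj x y (xP : bicom k x) (yP : bicom k y) : bv xP = bv yP -> x = y.
Proof. by case. Qed.

Lemma bvE x y (xP : bicom k x) (yP : bicom k y) : x = y -> bv xP = bv yP.
Proof. by move=> xy; apply: bcomP. Qed.

Lemma bvD x y (xP : bicom k x) (yP : bicom k y) xyP :
  @bv (x + y) xyP = bv xP + bv yP.
Proof. by apply: bcomP; rewrite //= addr0. Qed.

Lemma bvN x (xP : bicom k x) xP' : @bv (- x) xP' = - bv xP.
Proof. by apply: bcomP; rewrite //= oppr0. Qed.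

Lemma bvM x y (xP : bicom k x) (yP : bicom k y) xyP :
  @bv (x ** y) xyP = bv xP * bv yP.
Proof. by apply: bcomP; rewrite /= ?mulr0 // !scale0r !addr0. Qed.

Lemma bvZ a x (xP : bicom k x) axP : @bv (a%:C *: x) axP = bs a * bv xP.
Proof. by apply: bcomP; rewrite /= ?mulr0 // rngmul0r scale0r add0r addr0. Qed.

Lemma bsM a b : bs (a * b) = bs a * bs b.
Proof. by apply: bcomP; rewrite /= ?rmorphM // rngmul0r !scaler0 !addr0. Qed.

Lemma bsD a b : bs (a + b) = bs a + bs b.
Proof. by apply: bcomP; rewrite /= ?rmorphD // addr0. Qed.

Lemma bs1 : bs 1 = 1.
Proof. exact: bcomP. Qed.

End bicommutant_ring.

(** * Algebraic identities behind the functional calculus *)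

Section ring_identities.
Variable S : comNzRingType.
Implicit Types s k z y q m h : S.

Lemma sqrt_sqr z y : z + z = y + z * z -> (1 - z) * (1 - z) = 1 - y.
Proof.
move=> zy; have -> : (1 - z) * (1 - z) = 1 - (z + z) + z * z by ring.
by rewrite zy; ring.
Qed.

Lemma qinv_mul z q : z + q = z * q -> (1 - z) * (1 - q) = 1.
Proof.
move=> zq; have -> : (1 - z) * (1 - q) = 1 - (z + q) + z * q by ring.
by rewrite zq; ring.
Qed.

(** Multiply the inverses of 1 - k and 1 + k to invert 1 - k^2. *)
Lemma qinv_sqr k q q' : k + q = k * q -> - k + q' = - k * q' ->
  k * k + (q + q' - q * q') = k * k * (q + q' - q * q').
Proof.
move=> /qinv_mul kq /qinv_mul kq'.
have E : (1 - k * k) * (1 - (q + q' - q * q')) = 1.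
  transitivity (((1 - k) * (1 - q)) * ((1 - - k) * (1 - q'))); first by ring.
  by rewrite kq kq' mulr1.
apply/esym/subr0_eq; move: E; set K := k * k; set Q := q + q' - q * q' => E.
by transitivity ((1 - K) * (1 - Q) - 1); [ring|rewrite E subrr].
Qed.

Lemma hat_sqr s k y z : s * s = 2 -> y * 2 = k * k -> z + z = y + z * z ->
  (s * (k - k * z)) * (s * (k - k * z)) = k * k + k * k - k * k * (k * k).
Proof.
move=> ss yk /sqrt_sqr zy.
have -> : s * (k - k * z) * (s * (k - k * z)) =
  s * s * (k * k) * ((1 - z) * (1 - z)) by ring.
by rewrite ss zy -yk; ring.
Qed.

(** With b = 1 - K, whose inverse is 1 - q, the equation for z reads (1 - z)^2 = 1 + mu - mu b^-2.
    As v^2 = 1 - b^2, it follows that m b^2 (1 - z)^2 = m - v^2, and the second square is v^2 (m -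
    v^2). *)
Lemma gap_identity K q mu m r z v : r * r = m -> m * (1 + mu) = 1 ->
  K + q = K * q -> v * v = K + K - K * K ->
  z + z = - (mu * (q + q - q * q)) + z * z ->
  (v * v) * (v * v) + (r * (v - (K + z - K * z) * v)) * (r * (v - (K + z - K * z) * v))
  = m * (v * v).
Proof.
move=> rr m1 /qinv_mul Kq vv /sqrt_sqr z1.
set w := r * _.
have -> : w * w = (r * r) * (v * v) * (((1 - K) * (1 - K)) * ((1 - z) * (1 - z))).
  by rewrite /w; ring.
have -> : (1 - K) * (1 - K) * ((1 - z) * (1 - z)) =
    (1 + mu) * ((1 - K) * (1 - K)) - mu * (((1 - K) * (1 - q)) * ((1 - K) * (1 - q))).
  by rewrite z1; ring.
rewrite Kq rr; set b := 1 - K.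
have -> : v * v = 1 - b * b by rewrite vv /b; ring.
have -> : m * (1 - b * b) * ((1 + mu) * (b * b) - mu * (1 * 1)) =
  (1 - b * b) * ((m * (1 + mu)) * (b * b) - (m * (1 + mu)) + m) by ring.
by rewrite m1; ring.
Qed.

(** Here s = (1 - z)(1 - q) satisfies s^2 = 1: it is the sign of 1 - K, and p = (1 - s) / 2. Where s
    = -1, 1 - K = -(1 - z), that is K = 2 - z. *)
Lemma spectral_idem K q z h : h * 2 = 1 -> K + q = K * q ->
  z + z = K + K - K * K + z * z ->
  let p := h * (z + q - z * q) in p * p = p /\ K * p = p + p - z * p.
Proof.
move=> h2 /qinv_mul Kq /sqrt_sqr zK /=.
have -> : z + q - z * q = 1 - (1 - z) * (1 - q) by ring.
have -> : K = 1 - (1 - K) by ring.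
move: zK; have -> : 1 - (K + K - K * K) = (1 - K) * (1 - K) by ring.
have -> : z = 1 - (1 - z) by ring.
set a := 1 - z; set b := 1 - K in Kq *; set c := 1 - q in Kq *.
rewrite subKr => ab; split.
  transitivity (h * h * (1 - a * c - a * c + a * a * (c * c))); first by ring.
  rewrite ab; transitivity (h * h * (1 - a * c - a * c + (b * c) * (b * c))); first by ring.
  rewrite Kq; transitivity ((h * 2) * (h * (1 - a * c))); first by ring.
  by rewrite h2 mul1r.
apply: (@etrans _ _ (h * (1 - a * c - b + a * (b * c)))); first by ring.
rewrite Kq; transitivity (h * (1 - a * c + a - b * (b * c))); first by rewrite Kq; ring.
transitivity (h * (1 - a * c + a - (a * a) * c)); last by ring.
by rewrite ab; ring.
Qed.

(** Under p, K acts as 2 (1 - z/2), and 1 + n inverts 1 - z/2. *)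
Lemma spectral_inverse K z n p h : h * 2 = 1 ->
  K * p = p + p - z * p -> n = h * z + h * z * n -> K * (h * (p + n * p)) = p.
Proof.
move=> h2 Kp nE; transitivity (h * (1 + n) * (K * p)); first by ring.
rewrite Kp; transitivity ((h * 2) * p + (h * 2 * n - (h * z + h * z * n)) * p); first by ring.
by rewrite -nE h2; ring.
Qed.

Lemma spectral_idem_eq0 K q z h : h * 2 = 1 ->
  K + q = K * q -> h * (z + q - z * q) = 0 -> K = z.
Proof.
move=> h2 /qinv_mul Kq p0; apply/subr0_eq.
transitivity ((1 - z) * 1 - (1 - K)); first by ring.
rewrite -[X in _ * X - _]Kq; transitivity (- (1 - K) * ((h * 2) * (z + q - z * q))); first by rewrite h2; ring.
by rewrite mulrAC p0 mul0r mulr0.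
Qed.

End ring_identities.

(** * Spectral projections and nonzero idempotent multiples *)

Section spectral_projection.
Variables (R : realType) (A : cstarAlgType R).
Implicit Types (x y z k q h : A).

Lemma saZ (a : R) x : sa x -> sa (a%:C *: x).
Proof. by move=> sx; rewrite /sa starZr sx. Qed.

Lemma saD x y : sa x -> sa y -> sa (x + y).
Proof. by move=> sx sy; rewrite /sa starD sx sy. Qed.

Lemma saN x : sa x -> sa (- x).
Proof. by move=> sx; rewrite /sa starN sx. Qed.

Lemma saB x y : sa x -> sa y -> sa (x - y).
Proof. by move=> sx sy; rewrite /sa starB sx sy. Qed.

Lemma bicom_saM k x y : bicom k x -> bicom k y -> sa x -> sa y -> sa (x ** y).
Proof. by move=> kx ky sx sy; rewrite /sa starM sx sy (bicomC ky kx). Qed.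

Lemma rnorm_idem_le1 x : sa x -> x ** x = x -> rnorm x <= 1.
Proof.
move=> sx xx; have := rnorm_sa_sqr sx; rewrite xx; have := rnorm_ge0 x; nra.
Qed.

(* Let K = k^2 and y = 2 K - K^2, so that 1 - y = (1 - K)^2. Once norm y < 1 is
   known, 1 - y has a square root 1 - z, the absolute value of 1 - K, and
   p = (1 - (1 - z) (1 - K)^-1) / 2 is the spectral projection of K for ]1, +oo[.
   To bound y, write y = v^2 with v = sqrt 2 k (1 - K / 2)^(1/2) and, for some
   m < 1 given by the gap at 1, m - y = m (1 - x)^2. Then
   y^2 + (sqrt m (v - x v))^2 = m y, whence norm y <= m. *)
Lemma spectral_projection k q q' : sa k -> qinv k q -> qinv (- k) q' ->
  1 < rnorm k -> rnorm k ^+ 2 < 2 ->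
  exists p w, [/\ p <> 0, p ** p = p, k ** k ** w = p, rnorm p <= 1 & rnorm w <= 1].
Proof.
move=> sk kq kq' k1 k2.
have bk := @bicom_refl _ _ k.
have [_ sq] := sa_qinv sk (proj1 (proj1 (qinvP _ _) kq)).
have [_ sq'] := sa_qinv (saN sk) (proj1 (proj1 (qinvP _ _) kq')).
have bq : bicom k q := qinv_bicom kq.
have bq' : bicom k q' by apply: bicom_trans (bicomN bk) (qinv_bicom kq').
set K := k ** k; have bK : bicom k K := bicomM bk bk.
have sK : sa K := bicom_saM bk bk sk sk.
have KE : rnorm K = rnorm k ^+ 2 by exact: rnorm_sa_sqr.
have bqq : bicom k (q ** q') := bicomM bq bq'.
pose Q := q + q' - q ** q'; have bQ : bicom k Q := bicomB (bicomD bq bq') bqq.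
have sQ : sa Q by apply/saB; [exact: saD|exact: (bicom_saM bq bq')].
pose kk := bv bk; pose KK := bv bK; pose QQ := bv bQ.
have KKE : KK = kk * kk by exact: bvM.
have bB x y (bx : bicom k x) (by_ : bicom k y) bxy : @bv _ _ k (x - y) bxy = bv bx - bv by_.
  by rewrite (bvD bx (bicomN by_)) (bvN by_).
have KQ : KK + QQ = KK * QQ.
  have -> : QQ = bv bq + bv bq' - bv bq * bv bq'.
    by rewrite /QQ (bB _ _ (bicomD bq bq') bqq) (bvD bq bq') (bvM bq bq').
  rewrite KKE; apply: qinv_sqr.
    by rewrite -(bvD bk bq (bicomD bk bq)) -(bvM bk bq (bicomM bk bq)); apply: bvE; case: kq.
  rewrite -(bvN bk (bicomN bk)) -(bvD _ bq' (bicomD (bicomN bk) bq')).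
  by rewrite -(bvM _ bq' (bicomM (bicomN bk) bq')); apply: bvE; case: kq'.
have half2 : bs k (2^-1) * 2 = 1.
  have <- : bs k 2 = 2 by rewrite -[X in bs k X]/(1 + 1) bsD bs1.
  by rewrite -bsM mulVf ?bs1 ?pnatr_eq0.
pose y0 := (2^-1 : R)%:C *: K; have by0 : bicom k y0 := bicomZ _ bK.
have y0_lt : rnorm y0 < 1.
  by rewrite rnormZ ger0_norm ?invr_ge0 // KE; lra.
have [z0 [z0E _ /(bicom_trans by0) bz0 /(_ (saZ _ sK)) sz0]] := sqrt_exists y0_lt.
pose v := (Num.sqrt 2 : R)%:C *: (k - k ** z0).
have bv_ : bicom k v := bicomZ _ (bicomB bk (bicomM bk bz0)).
have sv : sa v by apply/saZ/saB => //; exact: (bicom_saM bk bz0).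
pose y := K + K - K ** K.
have by_ : bicom k y := bicomB (bicomD bK bK) (bicomM bK bK).
have yE : bv by_ = KK + KK - KK * KK.
  by rewrite (bB _ _ (bicomD bK bK) (bicomM bK bK)) (bvD bK bK) (bvM bK bK).
have vv : bv bv_ * bv bv_ = bv by_.
  rewrite yE (bvZ (bicomB bk (bicomM bk bz0))) (bB _ _ bk (bicomM bk bz0)) (bvM bk bz0).
  rewrite KKE; apply: (@hat_sqr _ _ _ (bv by0)).
  - by rewrite -bsM -expr2 sqr_sqrtr // -[X in bs k X]/(1 + 1) bsD bs1.
  - by rewrite (bvZ bK) mulrAC half2 mul1r.
  - rewrite -(bvD bz0 bz0 (bicomD bz0 bz0)) -(bvM bz0 bz0 (bicomM bz0 bz0)).
    by rewrite -(bvD by0 _ (bicomD by0 (bicomM bz0 bz0))); exact: bvE.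
have sy : sa y by apply/saB; [exact: saD|exact: (bicom_saM bK bK)].
(* As 1 - Q inverts 1 - K, Q2 = 1 - (1 - K)^-2. The choice of [mu] gives [mu] Q2 norm below 1, so
   that 1 + [mu] Q2 has a square root 1 - z1. *)
pose Q2 := Q + Q - Q ** Q.
have bQ2 : bicom k Q2 := bicomB (bicomD bQ bQ) (bicomM bQ bQ).
have sQ2 : sa Q2 by apply/saB; [exact: saD|exact: (bicom_saM bQ bQ)].
have Q20 := rnorm_ge0 Q2.
have Q21 : 0 < 1 + rnorm Q2 by rewrite ltr_pwDl.
pose mu := (1 + rnorm Q2)^-1; have mu0 : 0 < mu by rewrite invr_gt0.
pose m := (1 + mu)^-1; have m0 : 0 < m by rewrite invr_gt0 addr_gt0.
have m_lt1 : m < 1 by rewrite invf_lt1 ?ltrDl ?addr_gt0.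
pose y1 := - (mu%:C *: Q2); have by1 : bicom k y1 := bicomN (bicomZ _ bQ2).
have y1_lt : rnorm y1 < 1.
  by rewrite rnormN rnormZ gtr0_norm // mulrC ltr_pdivrMr // mul1r ltrDr.
have [z1 [z1E _ /(bicom_trans by1) bz1 /(_ (saN (saZ _ sQ2))) sz1]] := sqrt_exists y1_lt.
pose x := K + z1 - K ** z1.
have bx : bicom k x := bicomB (bicomD bK bz1) (bicomM bK bz1).
have sx : sa x by apply/saB; [exact: saD|exact: (bicom_saM bK bz1)].
pose r := Num.sqrt m; pose w := r%:C *: (v - x ** v).
have bw : bicom k w := bicomZ _ (bicomB bv_ (bicomM bx bv_)).
have sw : sa w by apply/saZ/saB => //; exact: (bicom_saM bx bv_).
have gap : y ** y + w ** w = m%:C *: y.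
  apply: (@bv_inj _ _ k _ _ (bicomD (bicomM by_ by_) (bicomM bw bw)) (bicomZ _ by_)).
  rewrite (bvD (bicomM by_ by_) (bicomM bw bw)) (bvM by_ by_) (bvM bw bw) (bvZ by_).
  rewrite (bvZ (bicomB bv_ (bicomM bx bv_))) (bB _ _ bv_ (bicomM bx bv_)) (bvM bx bv_).
  rewrite (bB _ _ (bicomD bK bz1) (bicomM bK bz1)) (bvD bK bz1) (bvM bK bz1) -vv.
  apply: (@gap_identity _ KK QQ (bs k mu)) => //.
  - by rewrite -bsM -expr2 sqr_sqrtr // ltW.
  - by rewrite -bs1 -bsD -bsM mulVf // gt_eqF // addr_gt0.
  - by rewrite vv yE.
  - rewrite -(bvD bz1 bz1 (bicomD bz1 bz1)) -(bvM bz1 bz1 (bicomM bz1 bz1)).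
    rewrite -(bvD bQ bQ (bicomD bQ bQ)) -(bvM bQ bQ (bicomM bQ bQ)).
    rewrite -(bB _ _ _ _ bQ2) -(bvZ bQ2 (bicomZ _ bQ2)) -(bvN _ by1).
    by rewrite -(bvD by1 _ (bicomD by1 (bicomM bz1 bz1))); exact: bvE.
have y_lt : rnorm y < 1.
  (* Thus |y|^2 <= |y^2 + w^2| = m |y| with m < 1. *)
  have := sa_rnorm_sqr sy sw (bicomC by_ bw).
  rewrite gap rnormZ gtr0_norm //; have := rnorm_ge0 y; nra.
have [z [zE z_le /(bicom_trans by_) bz /(_ sy) sz]] := sqrt_exists y_lt.
pose p := (2^-1 : R)%:C *: (z + Q - z ** Q).
have bp : bicom k p := bicomZ _ (bicomB (bicomD bz bQ) (bicomM bz bQ)).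
have sp : sa p by apply/saZ/saB; [exact: saD|exact: (bicom_saM bz bQ)].
have pE : bv bp = bs k (2^-1) * (bv bz + QQ - bv bz * QQ).
  rewrite (bvZ (bicomB (bicomD bz bQ) (bicomM bz bQ))).
  by rewrite (bB _ _ (bicomD bz bQ) (bicomM bz bQ)) (bvD bz bQ) (bvM bz bQ).
have zEb : bv bz + bv bz = KK + KK - KK * KK + bv bz * bv bz.
  rewrite -yE -(bvD bz bz (bicomD bz bz)) -(bvM bz bz (bicomM bz bz)).
  by rewrite -(bvD by_ _ (bicomD by_ (bicomM bz bz))); exact: bvE.
have [] := spectral_idem half2 KQ zEb; rewrite -pE => pp Kp.
have ppA : p ** p = p by apply: (@bv_inj _ _ k _ _ (bicomM bp bp) bp); rewrite (bvM bp bp).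
have p0 : p <> 0.
  (* If p = 0, then K = z has norm at most |y| < 1, against |K| = |k|^2 > 1. *)
  move=> p0; have KZ : K = z.
    apply: (@bv_inj _ _ k _ _ bK bz); apply: (spectral_idem_eq0 half2 KQ).
    by rewrite -pE; apply: bcomP.
  move: k1 z_le y_lt; rewrite -KZ KE => ? ? ?; nra.
(* As |z/2| < 1/2, the Neumann series gives |n| <= 1, whence |w| <= 1 for w = (p + n p) / 2. *)
pose y2 := (2^-1 : R)%:C *: z; have by2 : bicom k y2 := bicomZ _ bz.
have y2E : rnorm y2 = 2^-1 * rnorm z by rewrite rnormZ ger0_norm ?invr_ge0.
have y2_lt : rnorm y2 < 2^-1 by rewrite y2E; lra.
have [|n [nE n_le /(bicom_trans by2) bn]] := @neumann _ _ y2; first by lra.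
have n1 : rnorm n <= 1.
  by apply: le_trans n_le _; rewrite ler_pdivrMr; lra.
exists p, ((2^-1 : R)%:C *: (p + n ** p)); split => //.
- apply: (@bv_inj _ _ k _ _ (bicomM bK (bicomZ _ (bicomD bp (bicomM bn bp)))) bp).
  rewrite (bvM bK (bicomZ _ (bicomD bp (bicomM bn bp)))).
  rewrite (bvZ (bicomD bp (bicomM bn bp))) (bvD bp (bicomM bn bp)) (bvM bn bp).
  apply: (spectral_inverse half2 Kp).
  rewrite -(bvZ bz by2) -(bvM by2 bn (bicomM by2 bn)).
  by rewrite -(bvD by2 _ (bicomD by2 (bicomM by2 bn))); exact: bvE.
- exact: rnorm_idem_le1.
rewrite rnormZ ger0_norm ?invr_ge0 //.
have := rnorm_idem_le1 sp ppA; have := rnormD p (n ** p); have := rnorm_rngmul n p.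
have := rnorm_ge0 p; have := rnorm_ge0 n; nra.
Qed.

(** For k close to h, p h^2 w = p - t with |t| < 1, and a Neumann series inverts p - t relative to
    p. *)
Lemma sa_idem_factor h : real_rank0 A -> sa h -> rnorm h = 5 / 4 ->
  exists p s, [/\ p <> 0, p ** p = p & p = p ** (h ** h) ** s].
Proof.
(* With |h| = 5/4 and error 1/8, |k| lies between 9/8 and 11/8, so |k|^2 < 2, and |k^2 - h^2| <=
   (11/8 + 5/4) / 8 < 1. *)
move=> rr sh hE; have e0 : 0 < 8^-1 :> R by rewrite invr_gt0.
have [k [q [q' [sk kq kq' kh]]]] := rr0_qinv_dense2 rr sh e0.
have k_lt := rnormD (k - h) h; rewrite subrK in k_lt.
have k_gt := rnormB k (k - h); rewrite opprB addrC subrK in k_gt.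
have k1 : 1 < rnorm k by lra.
have k2 : rnorm k ^+ 2 < 2 by nra.
have [p [w [p0 pp Kw p1 w1]]] := spectral_projection sk kq kq' k1 k2.
pose t := p ** (k ** k - h ** h) ** w.
have KH : rnorm (k ** k - h ** h) < 1.
  have -> : k ** k - h ** h = k ** (k - h) + (k - h) ** h.
    by rewrite rngmulBr rngmulBl addrA subrK.
  have := rnormD (k ** (k - h)) ((k - h) ** h).
  have := rnorm_rngmul k (k - h); have := rnorm_rngmul (k - h) h.
  have := rnorm_ge0 (k - h); nra.
have t1 : rnorm t < 1.
  apply: le_lt_trans KH; apply: le_trans (rnorm_rngmul _ _) _.
  rewrite -[leRHS]mulr1; apply: ler_pM => //; try exact: rnorm_ge0.
  by apply: le_trans (rnorm_rngmul _ _) _; rewrite ler_piMl ?rnorm_ge0.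
have [n [nE _ _]] := neumann t1.
exists p, (w ** (p + n ** p)); split => //.
have tE : p ** (h ** h) ** w = p - t.
  by rewrite /t rngmulBr rngmulBl -(rngmulA p (k ** k)) Kw pp opprB addrC subrK.
have pt : p ** t = t by rewrite /t !rngmulA pp.
have pn : p ** n = n by rewrite {1}nE rngmulDr rngmulA pt -nE.
transitivity ((p - t) ** (p + n ** p)); last by rewrite -tE !rngmulA.
rewrite rngmulBl !rngmulDr pp (rngmulA p n) pn.
have <- : n ** p = t ** p + t ** (n ** p) by rewrite rngmulA -rngmulDl -nE.
by rewrite addrK.
Qed.

Lemma rr0_idem_rich : real_rank0 A -> idem_rich A.
Proof.
move=> rr z z0.
have nz : 0 < rnorm z by rewrite lt_def rnorm_ge0 andbT; apply/eqP => /rnorm_eq0.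
pose c : R := 5 / 4 / rnorm z ^+ 2.
have c0 : 0 < c by rewrite divr_gt0 ?exprn_gt0.
pose h := c%:C *: (star z ** z).
have sh : sa h by apply: saZ; rewrite /sa starM starK.
have hE : rnorm h = 5 / 4.
  by rewrite rnormZ gtr0_norm // rnorm_cstar divfK // expf_neq0 ?gt_eqF.
have [p [s [p0 pp pE]]] := sa_idem_factor rr sh hE.
(* One factor h of h^2 is expanded to exhibit z; the other goes into the left multiplier. *)
exists (c%:C *: (p ** h ** star z)), s.
suff <- : p = c%:C *: (p ** h ** star z) ** z ** s by [].
have hh : h ** h = c%:C *: (h ** star z ** z) by rewrite {2}/h rngmulZr rngmulA.
clearbody h; by rewrite [LHS]pE hh !rngmulZr !rngmulZl !rngmulA.
Qed.
End spectral_projection.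

Theorem corollary10p8 :
  (forall R : realType,
    ~ exists Gamma : functor Semb1 (RR0 R),
        nat_isomorphic (functor_comp V (functor_comp (RR0_to_Rngs R) Gamma))
                       forget_unit)
  /\
  (~ exists Gamma : functor Semb1 Reg,
        nat_isomorphic (functor_comp V (functor_comp Reg_to_Rngs Gamma))
                       forget_unit).
Proof.
split=> [R|] [Gamma].
  by apply: no_rich_lifting => X; exact: rr0_idem_rich (svalP (Gamma X)).
by apply: no_rich_lifting => X; exact: regular_idem_rich (svalP (Gamma X)).
Qed.
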